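(* Assume the following. (i) For all $t\in\Theta$, $\varphi_t$ is invertible and increasing from $I_1$ to $I_2$, where $I_1\subset\mathbb{R}$ is an interval and $I_2\subset\mathbb{R}$. (ii) For all $x\in I_2$, the map $t\mapsto\varphi_t^{-1}(x)$ is continuously differentiable on $\Theta$, with derivative denoted $\partial\varphi_t^{-1}(x)$. (iii) For all $t\in\Theta$, $\mathbb{E}\big[|\varphi_t^{-1}(\varphi_\theta(\varepsilon))|^2\big]<+\infty$. (iv) For every compact $B\subset\Theta$, $\mathbb{E}\big[\sup_{t\in B}|\partial\varphi_t^{-1}(\varphi_\theta(\varepsilon))|^4\big]<+\infty$. (v) $a<b$ are such that $[a,b]\subset\Theta$, $\theta\in\,]a,b[$, and $(t-\theta)M'(t)>0$ for all $t\in[a,b]$ with $t\neq\theta$. (vi) For all $x\in I_2$, $t\mapsto\varphi_t^{-1}(x)$ is twice differentiable on $\Theta$, with second derivative denoted $\partial^2\varphi_t^{-1}(x)$, and for every compact $B\subset\Theta$, $\mathbb{E}\big[\sup_{t\in B}|\partial^2\varphi_t^{-1}(\varphi_\theta(\varepsilon))|^2\big]<+\infty$. (vii) $M''(t)\ge1/2$ for all $t\in[a,b]$. Suppose moreover that $\varepsilon$ has a density $f$ and that, writing $d$ for differentiation with respect to $x$ and $\partial$ for differentiation with respect to $t$: (viii) $f$ is bounded and twice continuously differentiable on $I_1$, with bounded derivatives. (ix) For all $t\in\Theta$, $\varphi_t$ is three times continuously differentiable on $I_1$. (x) $\varphi_\theta^{-1}$ is three times continuously differentiable on $I_2$, with bounded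 derivatives. (xi) $d\varphi$, $d^2\varphi$, $d^3\varphi$, i.e. the functions $(t,x)\mapsto d^k\varphi_t(x)$ for $k=1,2,3$, are bounded on $\Theta\times I_1$. (xii) $(t,x)\mapsto\varphi_t(x)$ is twice continuously differentiable on $\Theta\times I_1$, and for each $x\in I_1$ the functions $t\mapsto\partial\varphi_t(x)$ and $t\mapsto\partial d\varphi_t(x)$ are bounded on $\Theta$. Let $\widehat f_n$ be the recursive kernel estimator defined in the context. Then, for all $x\in I_1$, $$\mathbb{E}\big[|\widehat f_n(x)-f(x)|^2\big]\xrightarrow[n\to\infty]{}0.$$
   Context: $\Theta\subset\mathbb{R}$ is an interval, $\theta\in\Theta$ is an (unknown) parameter, and $(\varphi_t)_{t\in\Theta}$ is a (known) family of real functions. $(\varepsilon_n)_{n\ge0}$ is a sequence of independent identically distributed real random variables with values in $I_1$, and $X_n=\varphi_\theta(\varepsilon_n)$ for all $n\ge0$. $\varepsilon$ and $X$ denote random variables with the same distribution as $\varepsilon_n$ and $X_n$, with $X=\varphi_\theta(\varepsilon)$. Put $Z_n(t)=\varphi_t^{-1}(X_n)$ and $$M(t)=\mathbb{E}\big[|\varphi_t^{-1}(\varphi_\theta(\varepsilon))-\varepsilon|^2\big],\quad t\in\Theta;$$ the first and second derivatives of $M$ are given by $M'(t)=-2\,\mathbb{E}\big[\partial\varphi_t^{-1}(X)(\varepsilon-\varphi_t^{-1}(X))\big]$ and $M''(t)=2\,\mathbb{E}\big[(\partial\varphi_t^{-1}(X))^2\big]-2\,\mathbb{E}\big[\partial^2\varphi_t^{-1}(X)(\varepsilon-\varphi_t^{-1}(X))\big]$.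 Let $\pi_{[a;b]}$ be the projection of $\mathbb{R}$ onto $[a,b]$: $\pi_{[a;b]}(x)=x$ if $a\le x\le b$, $=a$ if $x\le a$, $=b$ if $x\ge b$. Let $(\gamma_n)_{n\ge1}$ be a decreasing sequence of positive real numbers with $\sum_n\gamma_n=+\infty$ and $\sum_n\gamma_n^2<+\infty$. The sequence $(\widehat\theta_n)_{n\ge0}$ is defined by a deterministic $\widehat\theta_0\in[a,b]$ and, for $n\ge0$, $$\widehat\theta_{n+1}=\pi_{[a;b]}\big(\widehat\theta_n-\gamma_{n+1}T_{n+1}\big),\qquad T_{n+1}=-2\,\partial\varphi_{\widehat\theta_n}^{-1}(X_{n+1})\big(\varepsilon_{n+1}-\varphi_{\widehat\theta_n}^{-1}(X_{n+1})\big).$$ $K:\mathbb{R}\to\mathbb{R}$ is a positive, symmetric, integrable and bounded function with $\int_{\mathbb{R}}K(u)\,du=1$, $\lim_{|x|\to+\infty}|x|K(x)=0$ and $\int_{\mathbb{R}}u^2K(u)\,du<+\infty$. The bandwidth is $h_n=n^{-\alpha}$ with $0<\alpha<1$. The estimator is $$\widehat f_n(x)=\frac1n\sum_{i=1}^n\frac1{h_i}K\!\left(\frac{x-Z_i(\widehat\theta_{i-1})}{h_i}\right).$$ *)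

(* Defs.v *)
From HB Require Import structures.
From mathcomp Require Import all_boot all_order all_algebra.
From mathcomp Require Import finmap.
From mathcomp Require Import all_classical all_reals all_analysis.

Set Implicit Arguments.
Unset Strict Implicit.
Unset Printing Implicit Defensive.

Import Order.TTheory GRing.Theory Num.Theory.
Import numFieldNormedType.Exports.

Local Open Scope classical_set_scope.
Local Open Scope ring_scope.

(* Differential calculus on a subset [A] of the line, [A] being typically an
   interval that need not be open. The function need only be meaningful on [A]:
   increments leaving [A] are ignored, so derivatives are one-sided at the
   endpoints of [A] that belong to [A]. On open sets these notions are the
   library's [derivable] and [derive1], see [derivable_on_open] and
   [derive_on_open]. *)
Section calculus_on.
Context {R : realType}.
Implicit Types (A B : set R) (g : R -> R).

Definition diff_quotient_on A g (t : R) : set_system R :=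
  h^-1 * (g (h + t) - g t) @[h --> within [set h | A (h + t)] 0^'].

Definition derivable_on A g := forall t, A t -> cvg (diff_quotient_on A g t).

Definition derive_on A g (t : R) : R := lim (diff_quotient_on A g t).

Definition deriven_on A (k : nat) g : R -> R := iter k (derive_on A) g.

Fixpoint Ck_on (k : nat) A g : Prop :=
  {within A, continuous g} /\
  if k is k'.+1 then derivable_on A g /\ Ck_on k' A (derive_on A g) else True.

Definition partial1_on A (g : R -> R -> R) (t x : R) : R :=
  derive_on A (g ^~ x) t.

Definition partial2_on B (g : R -> R -> R) (t x : R) : R :=
  derive_on B (g t) x.

(* [g] is k times continuously differentiable on the rectangle [A `*` B]:
   all its partial derivatives up to order k exist and are jointly
   continuous. *)
Fixpoint Ck_on2 (k : nat) A B (g : R -> R -> R) : Prop :=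
  {within A `*` B, continuous (fun p : R * R => g p.1 p.2)} /\
  if k is k'.+1 then
    [/\ forall x, B x -> derivable_on A (g ^~ x),
        forall t, A t -> derivable_on B (g t),
        Ck_on2 k' A B (partial1_on A g) &
        Ck_on2 k' A B (partial2_on B g)]
  else True.

Let within_open A t : open A -> A t ->
  within [set h | A (h + t)] 0^' = (0 : R)^'.
Proof.
move=> oA At; apply/seteqP; split => U; last first.
  by rewrite /within/= => U0; apply: filterS U0 => h Uh _.
rewrite /within /= => U0.
have A0 : \forall h \near (0 : R), A (h + t).
  have h0 : (fun h : R => h + t) h @[h --> 0] --> t.
    by rewrite -[X in _ --> X]add0r; apply: cvgD; [exact: cvg_id|exact: cvg_cst].
  by apply: h0; exact: open_nbhs_nbhs.
have {}A0 : \forall h \near (0 : R)^', A (h + t).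
  by rewrite /dnbhs /within/=; apply: filterS A0 => h ? _.
by apply: filterS2 U0 A0 => h; exact.
Qed.

Lemma derive_on_open A g t : open A -> A t -> derive_on A g t = derive1 g t.
Proof. by move=> oA At; rewrite /derive_on /diff_quotient_on within_open. Qed.

Lemma derivable_on_open A g : open A ->
  derivable_on A g <-> forall t, A t -> derivable g t 1.
Proof.
move=> oA; suff E t : A t ->
    diff_quotient_on A g t = h^-1 *: (g (h *: (1 : R) + t) - g t) @[h --> 0^'].
  by split=> gA t At; have := gA t At; rewrite E.
move=> At; rewrite /diff_quotient_on within_open//.
suff -> : (fun h : R => h^-1 * (g (h + t) - g t)) =
    (fun h : R => h^-1 *: (g (h *: (1 : R) + t) - g t)) by [].
by apply/funext => h; rewrite /= [h *: (1 : R)]mulr1.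
Qed.

End calculus_on.

Section probability.
Context d (T : measurableType d) (R : realType) (P : probability T R).

Definition mutually_independent (X : nat -> {RV P >-> R}) :=
  forall (J : {fset nat}) (A : nat -> set R), (forall i, measurable (A i)) ->
  P (\bigcap_(i in [set` J]) (X i @^-1` A i)) =
  (\prod_(i <- J) P (X i @^-1` A i))%E.

Definition identically_distributed (X : nat -> {RV P >-> R}) :=
  forall (m n : nat) (A : set R), measurable A ->
  distribution P (X m) A = distribution P (X n) A.

Definition is_density (X : {RV P >-> R}) (f : R -> R) :=
  [/\ measurable_fun setT f, forall x, 0 <= f x &
      forall A : set R, measurable A ->
        distribution P X A = (\int[lebesgue_measure]_(x in A) (f x)%:E)%E].

End probability.

Section model.
Context {R : realType}.
Variables (Theta I1 : set R) (phi : R -> R -> R) (theta : R).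

(* [phi_inv t] is the inverse of the bijection [phi t] from [I1] onto its
   image; it is only evaluated on that image. *)
Definition phi_inv (t : R) : R -> R := 'pinv_(fun=> 0) I1 (phi t).

Definition dphi_inv (t x : R) : R := derive_on Theta (phi_inv ^~ x) t.

Definition d2phi_inv (t x : R) : R := deriven_on Theta 2 (phi_inv ^~ x) t.

Definition projection (a b x : R) : R :=
  if x <= a then a else if b <= x then b else x.

Section estimators.
Context d (T : measurableType d) (P : probability T R).
Variable eps : nat -> {RV P >-> R}.

Definition observation (n : nat) (w : T) : R := phi theta (eps n w).

(* The expectation depends only on the common law of the [eps n], of which
   [eps 0] is taken as the representative. *)
Definition M (t : R) : R :=
  fine 'E_P[fun w => `|phi_inv t (observation 0%N w) - eps 0%N w| ^+ 2].

Definition dM : R -> R := derive_on Theta M.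

Definition d2M : R -> R := deriven_on Theta 2 M.

Variables (a b theta0 : R) (gamma : nat -> R).

Fixpoint theta_hat (n : nat) (w : T) : R :=
  if n is n'.+1 then
    let t := theta_hat n' w in
    let x := observation n w in
    projection a b
      (t - gamma n * (- 2 * dphi_inv t x * (eps n w - phi_inv t x)))
  else theta0.

Definition bandwidth (alpha : R) (n : nat) : R := n%:R `^ (- alpha).

Definition f_hat (K : R -> R) (alpha : R) (n : nat) (x : R) (w : T) : R :=
  n%:R^-1 * \sum_(1 <= i < n.+1)
    (bandwidth alpha i)^-1 *
    K ((x - phi_inv (theta_hat i.-1 w) (observation i w)) / bandwidth alpha i).

End estimators.

End model.

(* Main.v *)
(** The pair (parameter estimate, estimation error of the density at x) is a
    Markov chain driven by the i.i.d. noise, so both mean-square errors obey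
    recursions of the form v_(n+1) <= (1 - a_n) v_n + a_n o(1) with divergent
    sum of the a_n.

    For the parameter, E T = M'(t) and M'' >= 1/2 give
    (t - theta) M'(t) >= (t - theta)^2 / 2, while E T^2 = O((t - theta)^2) because
    phi_t^{-1} and phi_theta^{-1} differ by at most |t - theta| times a derivative;
    hence a_n is half the step size, and convergence follows in mean square.

    For the density, a_n = 1/(n+1) and
    E ((1-a) r + a (Y - f))^2 <= (1-a) r^2 + a (E Y - f)^2 + a^2 E (Y - f)^2.
    The conditional mean of Y = h^{-1} K((x - Z)/h) given the parameter t is near
    f(x) when t is near theta and h is small, since Z = phi_t^{-1}(phi_theta(eps))
    and the inverse map phi_theta^{-1} o phi_t is Lipschitz, with local Lipschitz
    constants near 1 at (theta, x). *)

Require Import Defs.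
From HB Require Import structures.
From mathcomp Require Import all_boot all_order all_algebra.
From mathcomp Require Import finmap.
From mathcomp Require Import all_classical all_reals all_analysis.
From mathcomp Require Import measurable_realfun ring lra.

Set Implicit Arguments.
Unset Strict Implicit.
Unset Printing Implicit Defensive.

Import Order.TTheory GRing.Theory Num.Theory.
Import numFieldNormedType.Exports.

Local Open Scope classical_set_scope.
Local Open Scope ring_scope.

(** No density of [Z] is ever computed. A map that shrinks distances by a factor at most [L] has
    preimages at most [L] times as large as the set itself; used for the map and for its inverse,
    this encloses the law of [Z] near [x] between multiples of Lebesgue measure close to [f x]. The
    same comparison with global constants controls the tails. Conditional expectations are replaced
    by Tonelli: the past state is independent of the next noise, so one integrates over a fresh copy
    of the noise with the state frozen. The gradient noise vanishes at [theta]: its second moment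
    carries the factor [(t - theta) ^+ 2], so the quadratic term in the step is absorbed by the
    drift once the steps are small. Summability of the squared steps enters by making them tend to
    [0]. The two recursions are coupled through the bias: near [theta] it is small, and away from
    [theta] it is at most a multiple of [(t - theta) ^+ 2], whose mean is what the first recursion
    controls. The variance contributes a relative term of order [1 / (n h_n)], which vanishes
    because [alpha < 1]. *)

(* The measure structure on [pushforward] depends on a measurability proof that
   unification cannot find, so it is packaged explicitly. *)
Definition image_measure d d' (T : measurableType d) (T' : measurableType d')
    (R : realType) (m : {measure set T -> \bar R}) (g : T -> T')
    (mg : measurable_fun setT g) : {measure set T' -> \bar R}.
Proof.
by unshelve refine (pushforward m g : {measure set T' -> \bar R}).
Defined.

(** * Comparison of measures with Lebesgue measure *)

(** Lebesgue measure is an infimum over countable covers by half-open intervals, so a bound on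
    intervals extends to all measurable sets by countable subadditivity of [mu]. *)
Lemma measure_le_lebesgue (R : realType) (c : R)
    (mu : {measure set (measurableTypeR R) -> \bar R}) : 0 < c ->
  (forall u v, u <= v -> (mu `]u, v]%classic <= (c * (v - u))%:E)%E) ->
  forall A, measurable A -> (mu A <= c%:E * lebesgue_measure A)%E.
Proof.
move=> c0 muI A mA.
rewrite -lee_pdivrMl//.
rewrite /lebesgue_measure /lebesgue_stieltjes_measure /measure_extension /mu_ext.
apply: le_ereal_inf_tmp => _ [B [mB AB] <-].
have mB' k : measurable (B k : set (measurableTypeR R)).
  by apply: sub_sigma_algebra; exact: mB.
rewrite lee_pdivrMl// -nneseriesZl//.
apply: (@le_trans _ _ (\sum_(0 <= k <oo) mu (B k))%E).
  exact: measure_sigma_subadditive.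
apply: lee_nneseries => // k _.
have [[u v] _ <- /=] := mB k.
case: (leP u v) => uv.
  apply: le_trans (muI _ _ uv) _.
  by rewrite wlength_itv_bnd// EFinM.
have -> : `]u, v]%classic = set0 by apply: set_itv_ge; rewrite bnd_simp -leNgt ltW.
by rewrite measure0 wlength0 mule0.
Qed.

(* Substitute for a change of variables: it needs no regularity of the functions
   that will be integrated. *)
Lemma expanding_preimage (R : realType) (L : R) (D : set R) (g : R -> R) :
  0 < L -> measurable D -> measurable_fun D g ->
  (forall e e', D e -> D e' -> `|e - e'| <= L * `|g e - g e'|) ->
  forall A : set R, measurable A ->
  (lebesgue_measure (D `&` g @^-1` A) <= L%:E * lebesgue_measure A)%E.
Proof.
move=> L0 mD mg gL A mA.
have mg' : measurable_fun (setT : set (measurableTypeR R))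
    (g \_ D : measurableTypeR R -> measurableTypeR R).
  exact: (measurable_restrictT g mD).1 mg.
pose ml : {measure set (measurableTypeR R) -> \bar R} := mrestr lebesgue_measure mD.
pose mu := image_measure ml mg'.
have muE B : mu B = lebesgue_measure (D `&` g @^-1` B).
  rewrite /mu /= /pushforward /ml /= /mrestr; congr (lebesgue_measure _).
  apply/seteqP; split => [e [/= ge De]|e [De ge]]; split => //.
    by move: ge; rewrite /preimage/= /patch mem_set.
  by rewrite /preimage/= /patch mem_set.
rewrite -muE; apply: measure_le_lebesgue => // u v uv.
rewrite muE; set S := _ `&` _.
have [->|/set0P[e0 Se0]] := eqVneq S set0.
  by rewrite measure0 lee_fin mulr_ge0 ?subr_ge0 ?(ltW L0).
have mS : measurable S by exact: mg.
(* Two points of [S] have images in []u, v]], hence are at distance at most [L * (v - u)]; so [S]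
   fits into an interval of that length starting at its infimum. *)
have SL e e' : S e -> S e' -> e - L * (v - u) <= e'.
  move=> [De /=]; rewrite in_itv/= => /andP[ue ev].
  move=> [De' /=]; rewrite in_itv/= => /andP[ue' ev'].
  rewrite lerBlDr -lerBlDl (le_trans (ler_norm _))// (le_trans (gL _ _ De De'))//.
  by rewrite ler_pM2l// ler_norml; apply/andP; split; lra.
have lbS : has_inf S.
  split; first by exists e0.
  by exists (e0 - L * (v - u)) => e; exact: SL.
have SI : S `<=` `[inf S, inf S + L * (v - u)]%classic.
  move=> e Se; rewrite /= in_itv/= ge_inf/=//; last by case: lbS.
  rewrite -lerBlDr; apply: lb_le_inf; first by exists e0.
  by move=> e' Se'; exact: SL.
have mI : measurable `[inf S, inf S + L * (v - u)]%classic by exact: measurable_itv.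
apply: (@le_trans _ _ (lebesgue_measure `[inf S, inf S + L * (v - u)]%classic)).
  by apply: le_measure; rewrite ?inE.
rewrite lebesgue_measure_itv/=.
case: ifPn => _; rewrite -?EFinB lee_fin ?mulr_ge0 ?subr_ge0 ?(ltW L0)//.
by rewrite addrAC subrr add0r.
Qed.

(** Replacing both measures by their restrictions to [D] makes a comparison inside [D] sufficient;
    this matters because the sharp constants hold only locally. *)
Lemma ge0_integral_le_measure d (T : measurableType d) (R : realType)
    (m1 m2 : {measure set T -> \bar R}) (c : R) (D : set T) (f : T -> \bar R) :
  0 <= c -> measurable D ->
  (forall A, measurable A -> A `<=` D -> (m1 A <= c%:E * m2 A)%E) ->
  (forall x, (0 <= f x)%E) -> measurable_fun [set: T] f ->
  (\int[m1]_(x in D) f x <= c%:E * \int[m2]_(x in D) f x)%E.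
Proof.
move=> c0 mD m12 f0 mf.
have -> : (c%:E * \int[m2]_(x in D) f x = \int[mscale (NngNum c0) m2]_(x in D) f x)%E.
  by rewrite ge0_integral_mscale//; exact: measurable_funTS.
have restr (m : {measure set T -> \bar R}) :
    (\int[m]_(x in D) f x = \int[mrestr m mD]_(x in D) f x)%E.
  apply: eq_measure_integral => A mA AD.
  by rewrite /mrestr; congr (m _); apply/esym/setIidl.
rewrite (restr m1) (restr (mscale (NngNum c0) m2)).
apply: ge0_le_measure_integral => // S mS; rewrite /= /mrestr /mscale/=.
by apply: m12; [exact: measurableI|exact: subIsetr].
Qed.

(** * Independence and Markov chains driven by independent noise *)

Section independence.
Context d (T : measurableType d) (R : realType) (P : probability T R).
Context d1 d2 (E1 : measurableType d1) (E2 : measurableType d2).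
Variables (U : T -> E1) (V : T -> E2).
Hypotheses (mU : measurable_fun setT U) (mV : measurable_fun setT V).

Let Um : {mfun T >-> E1} := HB.pack U (isMeasurableFun.Build _ _ _ _ _ mU).
Let Vm : {mfun T >-> E2} := HB.pack V (isMeasurableFun.Build _ _ _ _ _ mV).

Let mUV : measurable_fun setT (fun w => (U w, V w)).
Proof. exact: measurable_fun_pair. Qed.

(* In the induction below the event [C] is an event on the noises still to come:
   it is carried along so that only products of two laws are ever needed. *)
Lemma independent_joint (C : set T) : measurable C ->
  (forall A B, measurable A -> measurable B ->
    P (U @^-1` A `&` V @^-1` B `&` C) = (P (U @^-1` A) * P (V @^-1` B) * P C)%E) ->
  forall D, measurable D ->
  P ((fun w => (U w, V w)) @^-1` D `&` C) =
  ((distribution P Um \x distribution P Vm) D * P C)%E.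
Proof.
move=> mC indep D mD.
have [PC0|PC0] := eqVneq (P C) 0%E.
  rewrite PC0 mule0; apply: (subset_measure0 _ _ _ PC0) => //.
  by apply: measurableI => //; rewrite -[X in measurable X]setTI; exact: mUV.
pose p := fine (P C).
have pE : P C = p%:E by rewrite fineK// fin_num_measure.
have p0 : 0 < p.
  by rewrite fine_gt0// measure_gt0 PC0/= ltey_eq fin_num_measure.
have ip0 : 0 <= p^-1 by rewrite invr_ge0 ltW.
(* The law of [(U, V)] conditioned on [C]. It agrees with the product of the two laws on rectangles,
   which determine the product measure. *)
pose m' := mscale (NngNum ip0) (image_measure (mrestr P mC) mUV).
rewrite (@product_measure_unique _ _ _ _ _ _ _ m')//; last first.
  move=> A B mA mB.
  transitivity (p^-1%:E * P (U @^-1` A `&` V @^-1` B `&` C))%E; first by [].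
  rewrite indep// pE muleC -muleA -EFinM mulfV ?mule1//.
  by rewrite gt_eqF.
rewrite /m' /mscale/= /pushforward /mrestr/= pE muleAC -EFinM mulVf ?mul1e//.
by rewrite gt_eqF.
Qed.

(** This takes the place of conditioning on [U]: the inner integral is the conditional mean, as an
    explicit function of [U w]. *)
Lemma independent_tonelli :
  (forall A B, measurable A -> measurable B ->
    P (U @^-1` A `&` V @^-1` B) = (P (U @^-1` A) * P (V @^-1` B))%E) ->
  forall f : E1 * E2 -> \bar R, (forall x, (0 <= f x)%E) ->
  measurable_fun setT f ->
  (\int[P]_w f (U w, V w) = \int[P]_w \int[distribution P Vm]_y f (U w, y))%E.
Proof.
move=> indep f f0 mf.
transitivity (\int[image_measure P mUV]_z f z)%E.
  by rewrite ge0_integral_pushforward// preimage_setT.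
rewrite (@eq_measure_integral _ _ _ _
  (distribution P Um \x distribution P Vm)%E); last first.
  move=> A mA _; have := @independent_joint setT measurableT.
  rewrite probability_setT => H; rewrite -[RHS]mule1 -H ?setIT//.
  by move=> B1 B2 mB1 mB2; rewrite setIT indep// mule1.
rewrite fubini_tonelli1// /fubini_F ge0_integral_distribution//.
- exact: measurable_fun_fubini_tonelli_F.
- by move=> y; apply: integral_ge0.
Qed.

End independence.

Section markov_chain.
Context d (T : measurableType d) (R : realType) (P : probability T R).
Variable V : nat -> {RV P >-> R}.
Hypotheses (V_indep : mutually_independent V) (V_id : identically_distributed V).
Context dE (E : measurableType dE) (G : nat -> E * R -> E) (S : nat -> T -> E).
Variable s0 : E.
Hypothesis (S0 : forall w, S 0%N w = s0).
Hypothesis (SS : forall n w, S n.+1 w = G n (S n w, V n.+1 w)).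
Hypothesis mG : forall n, measurable_fun setT (G n).

Lemma chain_measurable n : measurable_fun setT (S n).
Proof.
elim: n => [|n IH]; first by rewrite (funext S0 : S 0%N = cst s0); exact: measurable_cst.
rewrite (funext (SS n) : S n.+1 = G n \o (fun w => (S n w, V n.+1 w))).
by apply: measurableT_comp => //; exact: measurable_fun_pair.
Qed.

Let future (J : {fset nat}) (B : nat -> set R) :=
  \bigcap_(i in [set` J]) (V i @^-1` B i).

Let measurable_future J B : (forall i, measurable (B i)) -> measurable (future J B).
Proof.
move=> mB; apply: fin_bigcap_measurable => // i _.
by rewrite -[X in measurable X]setTI; exact: measurable_funP.
Qed.

(** The family of future noises makes the induction close: passing from [n] to [n.+1], an event on
    [V n.+1] is counted among the events in the future of [n]. *)
Let chain_future n (J : {fset nat}) (B : nat -> set R) A :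
  (forall i, i \in J -> n < i)%N ->
  (forall i, measurable (B i)) -> measurable A ->
  P (S n @^-1` A `&` future J B) = (P (S n @^-1` A) * P (future J B))%E.
Proof.
elim: n J B A => [|n IH] J B A Jn mB mA.
  rewrite (funext S0 : S 0%N = cst s0) preimage_cst; case: ifPn => _.
    by rewrite setTI probability_setT mul1e.
  by rewrite set0I measure0 mul0e.
have mS := chain_measurable n.
have key C1 C2 : measurable C1 -> measurable C2 ->
    P (S n @^-1` C1 `&` V n.+1 @^-1` C2 `&` future J B) =
    (P (S n @^-1` C1) * P (V n.+1 @^-1` C2) * P (future J B))%E.
  move=> mC1 mC2.
  pose B' i := if i == n.+1 then C2 else B i.
  have mB' i : measurable (B' i) by rewrite /B'; case: ifP.
  have nJ : n.+1 \notin J by apply/negP => /Jn; rewrite ltnn.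
  have futureE : V n.+1 @^-1` C2 `&` future J B = future (n.+1 |` J)%fset B'.
    apply/seteqP; split => [w [Vw JB] i /=|w JB].
      rewrite /B' in_fset1U => /orP[/eqP ->|iJ]; first by rewrite eqxx.
      by case: eqP iJ nJ => [-> ->//|_ iJ _]; exact: JB.
    split=> [|i /= iJ].
      by have := JB n.+1; rewrite /B' eqxx; apply => /=; rewrite fset1U1.
    have := JB i; rewrite /B' /=; case: eqP iJ nJ => [-> ->//|_ iJ _]; apply.
    by rewrite in_fset1U iJ orbT.
  have PJ : P (future (n.+1 |` J)%fset B') = (P (V n.+1 @^-1` C2) * P (future J B))%E.
    rewrite /future !V_indep// big_fsetU1//= {1}/B' eqxx; congr (_ * _)%E.
    apply: eq_big_seq => i iJ; rewrite /B'; case: eqP => // ni.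
    by move: nJ; rewrite -ni iJ.
  rewrite -setIA futureE IH//; first by rewrite PJ muleA.
  move=> i; rewrite in_fset1U => /orP[/eqP ->//|/Jn]; exact: ltnW.
(* Used twice: with the remaining future as [C] it factors the joint event, and below with
   [C = setT] it recognizes the product of laws as the probability of the event on [S n.+1]. *)
have E1 := independent_joint mS (measurable_funP (V n.+1)) (measurable_future J mB) key.
have mGA : measurable (G n @^-1` A) by rewrite -[X in measurable X]setTI; exact: mG.
have -> : S n.+1 @^-1` A = (fun w => (S n w, V n.+1 w)) @^-1` (G n @^-1` A).
  by apply/seteqP; split => w /=; rewrite SS.
rewrite E1//; congr (_ * _)%E.
have := @independent_joint _ _ _ P _ _ _ _ _ _ mS (measurable_funP (V n.+1))
  setT measurableT.
rewrite probability_setT => H; rewrite -[LHS]mule1 -H ?setIT//.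
move=> C1 C2 mC1 mC2; rewrite setIT mule1.
have {}IH := IH [fset n.+1]%fset (fun=> C2) C1.
have fE : future [fset n.+1]%fset (fun=> C2) = V n.+1 @^-1` C2.
  by rewrite /future set_fset1 bigcap_set1.
by rewrite -fE IH// => i; rewrite in_fset1 => /eqP ->.
Qed.

(** The Markov property in integrated form: [V n.+1] is independent of [S n] and has the law of
    [V 0], so an independent copy of [V 0] can replace it. *)
Lemma chain_tonelli n (f : E -> \bar R) :
  (forall x, (0 <= f x)%E) -> measurable_fun setT f ->
  (\int[P]_w f (S n.+1 w) =
   \int[P]_w \int[P]_w' f (G n (S n w, V 0%N w')))%E.
Proof.
move=> f0 mf; under eq_integral do rewrite SS.
rewrite (@independent_tonelli _ _ _ P _ _ _ _ _ _ (chain_measurable n)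
  (measurable_funP (V n.+1)) _ (f \o G n))//; last 3 first.
- move=> A B mA mB.
  have fE : future [fset n.+1]%fset (fun=> B) = V n.+1 @^-1` B.
    by rewrite /future set_fset1 bigcap_set1.
  by rewrite -fE chain_future// => i; rewrite in_fset1 => /eqP ->.
- by move=> x; exact: f0.
- exact: measurableT_comp.
apply: eq_integral => w _.
have mGw : measurable_fun setT (fun y => f (G n (S n w, y))).
  by do 2 apply: measurableT_comp => //; exact: measurable_pair1.
transitivity (\int[distribution P (V 0%N)]_y f (G n (S n w, y)))%E.
  by apply: eq_measure_integral => A mA _; exact: V_id.
by rewrite ge0_integral_distribution.
Qed.

Lemma measurable_chain_integral n (f : E -> \bar R) :
  (forall x, (0 <= f x)%E) -> measurable_fun setT f ->
  measurable_fun setT (fun w => \int[P]_w' f (G n (S n w, V 0%N w')))%E.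
Proof.
move=> f0 mf.
pose g (p : T * T) := f (G n (S n p.1, V 0%N p.2)).
have mg : measurable_fun setT g.
  do 2 apply: measurableT_comp => //; apply: measurable_fun_pair.
    by apply: (measurableT_comp (chain_measurable n)).
  exact: measurableT_comp.
have := @measurable_fun_fubini_tonelli_F _ _ _ _ _ P g mg (fun p => f0 _).
exact.
Qed.

End markov_chain.

(** * Limits within a set, linear recursions, joint measurability *)

Lemma within_cvg_to (I : Type) (F : set_system I) {FF : Filter F}
    (X : topologicalType) (A : set X) (u : I -> X) (x : X) :
  u i @[i --> F] --> x -> (\forall i \near F, A (u i)) ->
  u i @[i --> F] --> within A (nbhs x).
Proof.
move=> ux Au U; rewrite /within/= => /ux; rewrite /fmap/= => H.
by apply: filterS2 H Au => i /=; exact.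
Qed.

Lemma within_continuous_cvg (I : Type) (F : set_system I) {FF : Filter F}
    (X Y : topologicalType) (A : set X) (g : X -> Y) (u : I -> X) (x : X) :
  {within A, continuous g} -> A x ->
  u i @[i --> F] --> x -> (\forall i \near F, A (u i)) ->
  g (u i) @[i --> F] --> g x.
Proof.
move=> /subspace_continuousP gA Ax ux Au.
exact: (@cvg_comp _ _ _ u g _ _ _ (within_cvg_to ux Au) (gA _ Ax)).
Qed.

(** With error level [e / 2], subtracting the fixed point [e / 2] makes the recursion homogeneous;
    the factors [1 - a n <= expR (- a n)] multiply to the exponential of minus a divergent sum. *)
Lemma linear_recursion_cvg0 (R : realType) (v a : nat -> R) :
  (forall n, 0 <= v n) -> (\forall n \near \oo, a n <= 1) ->
  series a n @[n --> \oo] --> +oo ->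
  (forall e, 0 < e ->
    \forall n \near \oo, v n.+1 <= (1 - a n) * v n + a n * e) ->
  v n @[n --> \oo] --> 0.
Proof.
move=> v0 a1 Ay vrec; apply/cvgrPdist_le => e e0.
have e20 : 0 < e / 2 by rewrite divr_gt0.
have [N _ NH] : \forall n \near \oo,
    a n <= 1 /\ v n.+1 <= (1 - a n) * v n + a n * (e / 2).
  by apply: filterS2 a1 (vrec _ e20).
have bound k : v (N + k)%N - e / 2 <= v N * expR (series a N - series a (N + k)%N).
  elim: k => [|k IH]; first by rewrite addn0 subrr expR0 mulr1 lerBlDr lerDl ltW.
  have [ak1 vk] := NH (N + k)%N (leq_addr _ _).
  rewrite addnS; apply: (@le_trans _ _ ((1 - a (N + k)%N) * (v (N + k)%N - e / 2))).
    by rewrite mulrBr mulrBl mul1r lerBlDr; move: vk; lra.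
  apply: (@le_trans _ _ ((1 - a (N + k)%N) *
      (v N * expR (series a N - series a (N + k)%N)))).
    by rewrite ler_wpM2l// subr_ge0.
  rewrite seriesSr opprD addrA (expRD (series a N - series a (N + k)%N)).
  rewrite [leRHS]mulrA [leRHS]mulrC ler_wpM2r//.
    by rewrite mulr_ge0// expR_ge0.
  exact: expR_ge1Dx.
(* Beyond this threshold [1 + (series a n - series a N)] exceeds [v N / (e / 2)], and the
   exponential lies above this affine function. *)
have : \forall n \near \oo, v N / (e / 2) + series a N <= series a n.
  by move/cvgryPge : Ay; exact.
move=> [M _ MH].
exists (maxn N M) => // n /=; rewrite geq_max => /andP[Nn Mn].
rewrite sub0r normrN ger0_norm//.
have := bound (n - N)%N; rewrite subnKC// => bn.
rewrite [e]splitr -lerBlDr (le_trans bn)//.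
rewrite -opprB expRN ler_pdivrMr ?expR_gt0//.
apply: (@le_trans _ _ (e / 2 * (1 + (series a n - series a N)))); last first.
  by rewrite ler_wpM2l ?expR_ge1Dx// ltW.
rewrite -ler_pdivrMl// mulrC.
by have := MH n Mn => /=; lra.
Qed.

(* [t] is approximated by points of a countable grid. *)
Section caratheodory_function.
Context d (X : measurableType d) (R : realType).
Variables (a b : R) (D : set X) (g : R -> X -> R).
Hypotheses (ab : a <= b) (mD : measurable D).
Hypothesis mg : forall t, a <= t <= b -> measurable_fun D (g t).
Hypothesis cg : forall x, D x -> {within `[a, b], continuous (g ^~ x)}.

Let grid (n : nat) (k : int) : R := Num.min b (Num.max a (k%:~R / n.+1%:R)).

Let grid_itv n k : a <= grid n k <= b.
Proof. by rewrite /grid le_min ge_min ab le_max !lexx. Qed.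

Let step (n : nat) (t : R) : R := grid n (Num.floor (t * n.+1%:R)).

Let step_cvg t : a <= t <= b -> step n t @[n --> \oo] --> t.
Proof.
move=> /andP[at_ tb].
(* Rounding down moves [t] by at most one mesh, and clamping to [[a, b]], which contains [t], does
   not increase the distance to [t]. *)
have bnd n : `|t - step n t| <= n.+1%:R^-1.
  have n0 : 0 < n.+1%:R :> R by rewrite ltr0n.
  have /andP[f1 f2] := floor_itv (t * n.+1%:R).
  rewrite intrD in f2.
  set k := (Num.floor _)%:~R in f1 f2.
  have {}f1 : k / n.+1%:R <= t by rewrite ler_pdivrMr.
  have {}f2 : t <= k / n.+1%:R + n.+1%:R^-1.
    by rewrite -[X in _ + X]mul1r -mulrDl ler_pdivlMr// ltW.
  rewrite /step /grid -/k.
  have i0 : 0 <= n.+1%:R^-1 :> R by rewrite invr_ge0 ltW.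
  set K := k / n.+1%:R in f1 f2 *; set dl := n.+1%:R^-1 in f2 i0 *.
  clearbody K dl.
  by case: (leP a K) => ak; [case: (leP b K) => bk|case: (leP b a) => bk];
    rewrite ler_norml; apply/andP; split; lra.
apply/cvgrPdist_le => e e0; near=> n.
rewrite (le_trans (bnd n))// ltW//; near: n.
exact: (near_infty_natSinv_lt (PosNum e0)).
Unshelve. all: by end_near. Qed.

Lemma measurable_fun_caratheodory :
  measurable_fun (`[a, b] `*` D) (fun p : R * X => g p.1 p.2).
Proof.
apply: (@measurable_fun_cvg _ _ _ _ (fun n p => g (step n p.1) p.2))
  => [n|[t x] [/= tab Dx]]; last first.
  rewrite in_itv/= in tab.
  apply: (within_continuous_cvg (cg Dx)) => //; first exact: step_cvg.
  by near=> n; rewrite /= in_itv/=; exact: grid_itv.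
move=> _ Y mY.
(* For fixed [n] the domain splits into countably many strips on which the floor, hence the grid
   point, is constant; there the function depends on [x] alone. *)
have -> : (`[a, b] `*` D) `&` (fun p : R * X => g (step n p.1) p.2) @^-1` Y =
   \bigcup_(k : int)
     ((`[a, b] `&` (fun t : R => t * n.+1%:R) @^-1` `[k%:~R, (k + 1)%:~R[) `*`
     (D `&` g (grid n k) @^-1` Y)).
  apply/seteqP; split => [[t x] [[/= tab Dx] gY]|[t x] [k _ [/= [tab tk] [Dx gY]]]].
    exists (Num.floor (t * n.+1%:R)) => //; split=> //; split=> //=.
    by rewrite in_itv/= floor_itv.
  split=> //=; rewrite /step (@floor_def _ _ k)//.
apply: countable_bigcupT_measurable => // k.
apply: measurableX; last exact: mg.
apply: measurableI => //.
rewrite -[X in measurable X]setTI; apply: measurable_funM => //.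
Unshelve. all: by end_near. Qed.

End caratheodory_function.

(** * Derivatives relative to a subset of the line *)

Section derive_on_theory.
Context {R : realType}.
Implicit Types (A : set R) (g : R -> R).

Lemma diff_quotient_on_nbhs A g t : nbhs t A ->
  diff_quotient_on A g t = h^-1 * (g (h + t) - g t) @[h --> 0^'].
Proof.
move=> tA; rewrite /diff_quotient_on.
suff -> : within [set h | A (h + t)] 0^' = (0 : R)^' by [].
have A0 : \forall h \near (0 : R)^', A (h + t).
  apply: cvg_within.
  have h0 : (fun h : R => h + t) h @[h --> 0] --> t.
    by rewrite -[X in _ --> X]add0r; apply: cvgD; [exact: cvg_id|exact: cvg_cst].
  exact: h0.
apply/seteqP; split => U; last by rewrite /within/= => U0; apply: filterS U0 => h Uh _.
by rewrite /within/= => U0; apply: filterS2 U0 A0 => h; exact.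
Qed.

Lemma is_derive_derive_on A g t : nbhs t A -> cvg (diff_quotient_on A g t) ->
  is_derive t 1 g (derive_on A g t).
Proof.
move=> tA; rewrite /derive_on (diff_quotient_on_nbhs _ tA).
have -> : (fun h : R => h^-1 * (g (h + t) - g t)) =
    (fun h : R => h^-1 *: (g (h *: (1 : R) + t) - g t)).
  by apply/funext => h; rewrite /= [h *: (1 : R)]mulr1.
by move=> cg; split.
Qed.

Lemma derive_on_cvg A g t (I : Type) (F : set_system I) {FF : Filter F}
    (u : I -> R) : cvg (diff_quotient_on A g t) -> u i @[i --> F] --> 0 ->
  (\forall i \near F, u i != 0 /\ A (u i + t)) ->
  (u i)^-1 * (g (u i + t) - g t) @[i --> F] --> derive_on A g t.
Proof.
move=> cg u0 uA.
apply: (@cvg_comp _ _ _ u (fun h => h^-1 * (g (h + t) - g t)) _ _ _ _ cg).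
rewrite /within => U /= H.
have {}H : \forall h \near (0 : R), h != 0 -> A (h + t) -> U h by exact: H.
have {}H : \forall i \near F, u i != 0 -> A (u i + t) ->
    U (u i) by exact: (u0 _ H).
by apply: filterS2 H uA => i Hi [ui Ai]; exact: Hi.
Qed.

(* The [lim] of a divergent filter is the default value [0]. *)
Lemma derive_on_neq0 A g t : derive_on A g t != 0 ->
  cvg (diff_quotient_on A g t).
Proof.
by move=> H; apply: contrapT => /dvgP E; move: H; rewrite /derive_on E eqxx.
Qed.

Lemma derivable_on_within_continuous A g t : A t ->
  cvg (diff_quotient_on A g t) -> g x @[x --> within A (nbhs t)] --> g t.
Proof.
move=> At cg; apply/cvgrPdist_le => e e0.
pose F := within (A `&` [set s | s != t]) (nbhs t).
have FF : Filter F by exact: within_filter.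
have sF : s - t @[s --> F] --> (0 : R).
  rewrite -(subrr t); apply: cvgB; last exact: cvg_cst.
  by apply: cvg_within_filter; exact: cvg_id.
have FA : \forall s \near F, s - t != 0 /\ A (s - t + t).
  by rewrite /F; apply: filterS (withinT _ _) => s [As st]; rewrite subr_eq0 subrK.
have H := derive_on_cvg cg sF FA.
have {}H := cvgM sF (H FF).
rewrite mul0r in H.
have : \forall s \near F, `|0 - (s - t) * ((s - t)^-1 * (g (s - t + t) - g t))| <= e.
  by move/cvgrPdist_le : (H FF); exact.
rewrite near_withinE => {}H.
apply: (@filterS _ (nbhs t) _ _ _ _ H) => s Hs As.
have [->|st] := eqVneq s t; first by rewrite subrr normr0 ltW.
have := Hs (conj As st).
by rewrite subrK mulrA mulfV ?subr_eq0// mul1r sub0r normrN distrC.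
Qed.

(** Points strictly between [s] and [t] are interior to [A], where the relative derivative is the
    ordinary one; so the classical theorem applies even if [s] or [t] is an endpoint of [A]. *)
Lemma derive_on_MVT A g s t : s < t -> `[s, t] `<=` A ->
  (forall c, s < c < t -> cvg (diff_quotient_on A g c)) ->
  {within `[s, t], continuous g} ->
  exists2 c, s < c < t & g t - g s = derive_on A g c * (t - s).
Proof.
move=> st stA dg cg.
have [] := @MVT R g (derive_on A g) s t st.
- move=> c; rewrite in_itv/= => sct; apply: is_derive_derive_on; last exact: dg.
  have : nbhs c `]s, t[%classic.
    by apply: open_nbhs_nbhs; split => //; exact: interval_open.
  apply: filterS => x /= xst; apply: stA; move: xst; rewrite /= !in_itv/= => /andP[? ?].
  by apply/andP; split; exact: ltW.
- exact: cg.
- by move=> c; rewrite in_itv/= => sct E; exists c.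
Qed.

End derive_on_theory.

(** * Kernel means *)

Section density_transfer.
Context d (T : measurableType d) (R : realType) (P : probability T R).
Variables (X : {RV P >-> R}) (f : R -> R) (I : set R) (g : R -> R).
Hypotheses (Xf : is_density X f) (mI : measurable I) (XI : forall w, I (X w)).
Hypothesis mg : measurable_fun I g.

Lemma measurable_fun_comp_range : measurable_fun setT (g \o X).
Proof.
move=> _ A mA; rewrite setTI.
have -> : (g \o X) @^-1` A = X @^-1` (I `&` g @^-1` A).
  by apply/seteqP; split => w /=; [split|case].
by rewrite -[X in measurable X]setTI; apply: measurable_funP => //; exact: mg.
Qed.

Let Y := g \o X.

Let PYE A : measurable A ->
  P (Y @^-1` A) = (\int[lebesgue_measure]_(e in I `&` g @^-1` A) (f e)%:E)%E.
Proof.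
move=> mA; have [_ _ <-] := Xf; last exact: mg.
congr (P _); apply/seteqP; split => w /=; last by case.
by move=> Aw; split => //; exact: XI.
Qed.

Let mf S : measurable S -> measurable_fun S (EFin \o f).
Proof.
move=> mS; apply/measurable_EFinP; apply: measurable_funTS.
by have [] := Xf.
Qed.

(** Inside [Q], [L] bounds the size of a preimage under [g] and [c] the density on it, so the law of
    [g \o X] is at most [c * L] times Lebesgue measure. Both constants are local to [Q]. *)
Lemma density_transfer_le (L c : R) (Q : set R) (G : R -> \bar R) :
  0 < L -> 0 <= c -> measurable Q ->
  (forall e e', I e -> I e' -> Q (g e) -> Q (g e') ->
    `|e - e'| <= L * `|g e - g e'|) ->
  (forall e, I e -> Q (g e) -> f e <= c) ->
  (forall u, (0 <= G u)%E) -> measurable_fun setT G ->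
  (\int[P]_(w in (g \o X) @^-1` Q) G (g (X w)) <=
   (c * L)%:E * \int[lebesgue_measure]_(u in Q) G u)%E.
Proof.
move=> L0 c0 mQ gL fc G0 mG.
have mY : measurable_fun setT (g \o X : T -> measurableTypeR R).
  exact: measurable_fun_comp_range.
rewrite -(@ge0_integral_pushforward _ _ _ _ _ _ mY P _ G)//; last exact: measurable_funTS.
apply: (@ge0_integral_le_measure _ _ _ (image_measure P mY) lebesgue_measure
  (c * L) Q G) => //.
  by rewrite mulr_ge0// ltW.
move=> A mA AQ; rewrite [leLHS]PYE//.
have mIA : measurable (I `&` g @^-1` A) by exact: mg.
apply: (@le_trans _ _ (\int[lebesgue_measure]_(e in I `&` g @^-1` A) c%:E)%E).
  apply: ge0_le_integral => //.
  - by move=> e _; rewrite lee_fin; have [_ ->] := Xf.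
  - exact: mf.
  - by move=> e [Ie Ae]; rewrite lee_fin fc//; exact: AQ.
rewrite integral_cst// EFinM -muleA lee_wpmul2l//.
have -> : I `&` g @^-1` A = (I `&` g @^-1` Q) `&` g @^-1` A.
  by apply/seteqP; split => e /= => [[Ie Ae]|[[]]//]; do !split => //; exact: AQ.
apply: expanding_preimage => //; first exact: mg.
  by apply: measurable_funS mg => //; exact: subIsetl.
by move=> e e' [Ie Qe] [Ie' Qe']; exact: gL.
Qed.

(** The reverse bound uses the inverse [r]: if [r] does not shrink distances by more than [L], a set
    is at most [L] times as large as its preimage under [g], on which the density is at least
    [c]. *)
Lemma density_transfer_ge (L c : R) (Q : set R) (r : R -> R) (G : R -> \bar R) :
  0 < L -> 0 < c -> measurable Q -> measurable_fun Q r ->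
  (forall u, Q u -> I (r u) /\ g (r u) = u) ->
  (forall e, I e -> Q (g e) -> r (g e) = e) ->
  (forall u u', Q u -> Q u' -> `|u - u'| <= L * `|r u - r u'|) ->
  (forall e, I e -> Q (g e) -> c <= f e) ->
  (forall u, (0 <= G u)%E) -> measurable_fun setT G ->
  (\int[lebesgue_measure]_(u in Q) G u <=
   (L / c)%:E * \int[P]_(w in (g \o X) @^-1` Q) G (g (X w)))%E.
Proof.
move=> L0 c0 mQ mr rg gr rL fc G0 mG.
have mY : measurable_fun setT (g \o X : T -> measurableTypeR R).
  exact: measurable_fun_comp_range.
rewrite -(@ge0_integral_pushforward _ _ _ _ _ _ mY P _ G)//; last exact: measurable_funTS.
apply: (@ge0_integral_le_measure _ _ _ lebesgue_measure (image_measure P mY)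
  (L / c) Q G) => //.
  by rewrite divr_ge0// ltW.
move=> A mA AQ; rewrite [X in (_ <= _ * X)%E]PYE//.
have mIA : measurable (I `&` g @^-1` A) by exact: mg.
(* [A] is the preimage under [r] of its own preimage under [g], so [expanding_preimage] applies to
   [r]. *)
have AE : A = Q `&` r @^-1` (I `&` g @^-1` A).
  apply/seteqP; split => [u Au|u [Qu [/=]]]; last by have [_ ->] := rg _ Qu.
  by have [Iu gu] := rg _ (AQ _ Au); split; [exact: AQ|split=> //=; rewrite gu].
rewrite [in leLHS]AE.
apply: (le_trans (expanding_preimage L0 mQ mr _ mIA)) => //.
rewrite EFinM -muleA lee_wpmul2l ?lee_fin ?(ltW L0)//.
rewrite lee_pdivlMl//.
rewrite -integral_cst//; apply: ge0_le_integral => //.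
- by move=> e _; rewrite lee_fin ltW.
- exact: mf.
- by move=> e [Ie Ae]; rewrite lee_fin fc//; exact: AQ.
Qed.

End density_transfer.

Section kernel_mean.
Context d (T : measurableType d) (R : realType) (P : probability T R).
Variables (X : {RV P >-> R}) (f : R -> R) (I : set R).
Hypotheses (Xf : is_density X f) (I_itv : is_interval I) (XI : forall w, I (X w)).
Variable F : R.
Hypotheses (F0 : 0 < F) (fF : forall e, I e -> f e <= F).
Variable K : R -> R.
Hypotheses (K0 : forall u, 0 <= K u) (mK : measurable_fun setT K).
Hypothesis K1 : (\int[lebesgue_measure]_u (K u)%:E = 1)%E.

Let mEK : measurable_fun setT (EFin \o K).
Proof. exact/measurable_EFinP. Qed.

(** Monotone convergence along []-n, n[]; the tail follows by subtraction from the total mass [1],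
    once the central integral is known to be finite. *)
Lemma kernel_tail (eta : R) : 0 < eta -> exists2 rho : R, 0 < rho &
  forall s : R, rho <= s ->
  ((1 - eta)%:E <= \int[lebesgue_measure]_(u in `](- s)%R, s[) (K u)%:E)%E /\
  (\int[lebesgue_measure]_(u in ~` `](- s)%R, s[) (K u)%:E <= eta%:E)%E.
Proof.
move=> eta0.
pose J (n : nat) := `]- (n%:R : R), n%:R[%classic.
have : (\int[lebesgue_measure]_(u in J n) (K u)%:E)%E @[n --> \oo] --> 1%E.
  rewrite -K1 -[in X in _ --> X](bigcup_itvT false true).
  apply: ge0_nondecreasing_set_cvg_integral => //.
  - move=> m n mn; apply/subsetPset => u; rewrite /J /= !in_itv/= => /andP[mu um].
    have mn' : m%:R <= n%:R :> R by rewrite ler_nat.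
    by apply/andP; split; lra.
  - by move=> n; exact: measurable_itv.
  - by move=> n; exact: (measurable_funTS mEK).
  - by move=> n u _; rewrite lee_fin.
move=> /fine_cvgP[Jfin /cvgrPdist_lt/(_ _ eta0) Jeta].
pose k n := (\int[lebesgue_measure]_(u in J n) (K u)%:E)%E.
have [n [Jn1 Jn2 n0]] : exists n,
    [/\ k n \is a fin_num, `|1 - fine (k n)| < eta & (0 < n)%N].
  have : \forall n \near \oo,
      k n \is a fin_num /\ `|1 - fine (k n)| < eta /\ (0 < n)%N.
    by apply: filterS3 Jfin Jeta (nbhs_infty_gt 0) => n.
  by move=> [n _ /(_ n (leqnn n))[? [? ?]]]; exists n.
exists n%:R; first by rewrite ltr0n.
move=> s ns.
have E1 : ((1 - eta)%:E <= \int[lebesgue_measure]_(u in `](- s)%R, s[) (K u)%:E)%E.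
  apply: (@le_trans _ _ (\int[lebesgue_measure]_(u in J n) (K u)%:E)%E).
    rewrite -[X in (_ <= X)%E]/(k n) -(fineK Jn1) lee_fin; move: Jn2; rewrite ltr_norml => /andP[_]; lra.
  apply: ge0_subset_integral => //.
  - exact: measurable_itv.
  - exact: (measurable_funTS mEK).
  - by move=> u _; rewrite lee_fin.
  - by move=> u; rewrite /J /= !in_itv/= => /andP[? ?]; apply/andP; split; lra.
split=> //.
have mJ : measurable (`]-s, s[%classic : set R) by exact: measurable_itv.
have := K1; rewrite -(setUv `]-s, s[%classic) ge0_integral_setU//; last 4 first.
- exact: measurableC.
- exact: (measurable_funTS mEK).
- by move=> u _; rewrite lee_fin.
- by apply/disj_setPCl.
move=> E2.
have fin1 : (\int[lebesgue_measure]_(u in `](- s)%R, s[) (K u)%:E)%E \is a fin_num.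
  rewrite ge0_fin_numE; last by apply: integral_ge0 => u _; rewrite lee_fin.
  rewrite (le_lt_trans _ (ltry 1))// -E2 leeDl// integral_ge0// => u _.
  by rewrite lee_fin.
move: E2 E1; rewrite -(fineK fin1) lee_fin.
move: (fine _) => k0.
case: (integral _ (~` _) _) => [k'||]//=.
by rewrite -EFinD lee_fin => -[] ? ?; lra.
Qed.

Variables (psi chi : R -> R -> R) (B : set R) (L : R).
Hypothesis L0 : 0 < L.
Hypotheses (psiI : forall t e, B t -> I e -> I (psi t e))
  (chiI : forall t e, B t -> I e -> I (chi t e))
  (psiK : forall t e, B t -> I e -> chi t (psi t e) = e)
  (chiK : forall t e, B t -> I e -> psi t (chi t e) = e)
  (mpsi : forall t, B t -> measurable_fun I (psi t))
  (mchi : forall t, B t -> measurable_fun I (chi t))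
  (chiL : forall t z z', B t -> I z -> I z' -> `|chi t z - chi t z'| <= L * `|z - z'|).

Let mI : measurable I. Proof. exact: is_interval_measurable. Qed.

Let g x h t e : R := (x - psi t e) / h.

Let mg x h t : B t -> measurable_fun I (g x h t).
Proof.
move=> Bt; apply: measurable_funM => //; apply: measurable_funB => //; exact: mpsi.
Qed.

Let gE x h t e e' : 0 < h -> `|psi t e - psi t e'| = h * `|g x h t e - g x h t e'|.
Proof.
move=> h0; rewrite /g -mulrBl normrM normfV (gtr0_norm h0) mulrCA divff ?gt_eqF// mulr1.
by rewrite distrC; congr `| _ |; ring.
Qed.

(** Since [chi t] is [L]-Lipschitz, the rescaled map [(x - psi t e) / h] separates points up to the
    constant [L * h]: this is the origin of the factor [h]. [Q] and [G] stay general to cover the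
    tails and the square of the kernel. *)
Lemma kernel_mean_le x h t (Q : set R) (G : R -> \bar R) : B t -> 0 < h ->
  measurable Q -> (forall u, (0 <= G u)%E) -> measurable_fun setT G ->
  (\int[P]_(w in (fun w => ((x - psi t (X w)) / h)%R) @^-1` Q)
     G ((x - psi t (X w)) / h)%R <=
   (F * L * h)%:E * \int[lebesgue_measure]_(u in Q) G u)%E.
Proof.
move=> Bt h0 mQ G0 mG; rewrite -[F * L * h]mulrA.
apply: (@density_transfer_le _ _ _ _ _ _ _ (g x h t) Xf mI XI (mg x h Bt)
  (L * h) F Q G) => //.
- by rewrite mulr_gt0.
- exact: ltW.
- move=> e e' Ie Ie' _ _; rewrite -[L * h * _]mulrA -gE//.
  by have := chiL Bt (psiI Bt Ie) (psiI Bt Ie'); rewrite !psiK.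
- by move=> e Ie _; exact: fF.
Qed.

Variables x theta : R.
Hypothesis fx0 : 0 <= f x.
Hypothesis fpos : 0 < f x -> exists2 r : R, 0 < r & forall z, `|z - x| < r -> I z.
Hypothesis local : forall eta : R, 0 < eta -> exists2 delta : R, 0 < delta &
  forall t : R, B t -> `|t - theta| < delta ->
  forall z z', I z -> I z' -> `|z - x| < delta -> `|z' - x| < delta ->
  `|chi t z - chi t z' - (z - z')| <= eta * `|z - z'| /\ `|f (chi t z) - f x| <= eta.

Lemma kernel_mean_approx (eta : R) : 0 < eta -> exists2 delta : R, 0 < delta &
  forall t h : R, B t -> `|t - theta| < delta -> 0 < h < delta ->
  (((f x - eta) * h)%:E <= \int[P]_w (K ((x - psi t (X w)) / h)%R)%:E)%E /\
  (\int[P]_w (K ((x - psi t (X w)) / h))%:E <= ((f x + eta) * h)%:E)%E.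
Proof.
move=> eta0.
(* [ep * c] dominates both final errors: the upper one is [ep * (1 + 2 * f x + 2 * ep + F * L)] with
   [2 * ep < 1], the lower one at most [ep * (1 + 2 * f x)]. *)
pose c := 2 + 2 * f x + F * L.
have c0 : 0 < c by rewrite /c; have := mulr_gt0 F0 L0; move: fx0; lra.
have [ep [ep0 ep1 epc epf]] : exists ep : R,
    [/\ 0 < ep, ep < 2^-1, ep * c <= eta & 0 < f x -> ep < f x].
  have [fp|fn] := ltP 0 (f x).
    exists (Num.min (4^-1) (Num.min (eta / c) (f x / 2))).
    have ec : 0 < eta / c by rewrite divr_gt0.
    split; rewrite ?lt_min ?gt_min ?ler_pdivlMr// -?ler_pdivlMr ?ge_min ?lexx ?orbT//.
    - by rewrite ec divr_gt0// invr_gt0 andbT ltr0n.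
    - by apply/orP; left; lra.
    - by move=> _; apply/orP; right; apply/orP; right; lra.
  exists (Num.min (4^-1) (eta / c)).
  have ec : 0 < eta / c by rewrite divr_gt0.
  split; rewrite ?lt_min ?gt_min -?ler_pdivlMr ?ge_min ?lexx ?orbT//.
  - by rewrite ec andbT invr_gt0 ltr0n.
  - by apply/orP; left; lra.
have [dl dl0 locd] := local ep0.
have [rho rho0 tail] := kernel_tail ep0.
(* If [f x] vanishes, [r = 1] is a dummy value: only the lower bound for positive [f x] needs the
   window inside [I]. *)
have [r r0 rI] : exists2 r : R, 0 < r & 0 < f x -> forall z, `|z - x| < r -> I z.
  have [fp|fn] := ltP 0 (f x).
    by have [r r0 rI] := fpos fp; exists r.
  by exists 1 => // /lt_le_trans => /(_ _ fn); rewrite ltxx.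
pose dm := Num.min dl r.
have dm0 : 0 < dm by rewrite lt_min dl0.
(* The condition [h < dm / rho] gives [s = dm / h >= rho]: the window [|z - x| < dm], rescaled by
   [h], carries all but [ep] of the kernel mass. *)
exists (Num.min dl (dm / rho)); first by rewrite lt_min dl0 divr_gt0.
move=> t h Bt; rewrite !lt_min => /andP[tdl _] /andP[h0 /andP[_ hdm]].
set s := dm / h.
have rs : rho <= s by rewrite /s ler_pdivlMr// mulrC -ler_pdivlMr// ltW.
have [tail1 tail2] := tail _ rs.
set Q : set R := `]-s, s[%classic.
have mQ : measurable Q by exact: measurable_itv.
have QP u : Q u -> `|h * u| < dm.
  rewrite /Q /= in_itv/= => /andP[su us].
  by rewrite normrM (gtr0_norm h0) -ltr_pdivlMl// mulrC ltr_norml su.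
have gQ e : Q (g x h t e) -> `|psi t e - x| < dm.
  by move=> /QP; rewrite /g mulrC divfK ?gt_eqF// distrC.
have dmdl : dm <= dl by rewrite ge_min lexx.
have dmr : dm <= r by rewrite ge_min lexx orbT.
have loc e e' : I e -> I e' -> Q (g x h t e) -> Q (g x h t e') ->
    `|e - e' - (psi t e - psi t e')| <= ep * `|psi t e - psi t e'| /\
    `|f e - f x| <= ep.
  move=> Ie Ie' /gQ Qe /gQ Qe'.
  have := locd t Bt tdl _ _ (psiI Bt Ie) (psiI Bt Ie').
  by rewrite !psiK//; apply; [exact: lt_le_trans Qe dmdl|exact: lt_le_trans Qe' dmdl].
pose Y (w : T) : R := g x h t (X w).
have mY : measurable_fun setT Y by exact: (measurable_fun_comp_range mI XI (mg x h Bt)).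
have mYQ : measurable (Y @^-1` Q) by rewrite -[X in measurable X]setTI; exact: mY.
have mKY : measurable_fun setT (fun w => (K (Y w))%:E).
  by apply/measurable_EFinP; exact: measurableT_comp.
have KY0 w : (0 <= (K (Y w))%:E)%E by rewrite lee_fin.
have intE : (\int[P]_w (K (Y w))%:E = \int[P]_(w in Y @^-1` Q) (K (Y w))%:E +
   \int[P]_(w in Y @^-1` (~` Q)) (K (Y w))%:E)%E.
  rewrite preimage_setC -ge0_integral_setU ?setUv//.
  - exact: measurableC.
  - by apply/disj_setPCl.
rewrite -/(\int[P]_w (K (Y w))%:E)%E.
have EK0 : forall u, (0 <= (EFin \o K) u)%E by move=> u /=; rewrite lee_fin.
have hip : 0 < 1 - ep by rewrite subr_gt0 (lt_trans ep1)// invf_lt1// ltr1n.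
have fep0 : 0 <= f x + ep by rewrite addr_ge0// ltW.
have ep20 : 0 < 1 + 2 * ep by rewrite addr_gt0// mulr_gt0.
split; last first.
  rewrite intE.
  (* In the window the density is at most [f x + ep] and the distance constant at most
     [(1 + 2 * ep) * h]; outside, the global bound [F * L * h] multiplies a kernel mass at most
     [ep]. *)
  apply: (@le_trans _ _ (((f x + ep) * ((1 + 2 * ep) * h))%:E * 1 +
      (F * L * h)%:E * ep%:E)%E).
    apply: leeD.
      apply: (@le_trans _ _ (((f x + ep) * ((1 + 2 * ep) * h))%:E *
        \int[lebesgue_measure]_(u in Q) (K u)%:E)%E); last first.
        rewrite lee_wpmul2l ?lee_fin//.
          by rewrite !mulr_ge0// ltW.
        rewrite -K1; apply: ge0_subset_integral => //.
        by move=> u _; rewrite lee_fin.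
      apply: (@density_transfer_le _ _ _ _ _ _ _ (g x h t) Xf mI XI (mg x h Bt)
        ((1 + 2 * ep) * h) (f x + ep) Q (EFin \o K)) => //.
      - by rewrite mulr_gt0.
      - move=> e e' Ie Ie' Qe Qe'; rewrite -[_ * h * _]mulrA -gE//.
        have [H _] := loc _ _ Ie Ie' Qe Qe'.
        rewrite -[e - e'](subrK (psi t e - psi t e')) (le_trans (ler_normD _ _))//.
        rewrite mulrDl mul1r addrC lerD2l (le_trans H)// ler_wpM2r//.
        by rewrite ler_peMl ?(ltW ep0)// ler1n.
      - move=> e Ie Qe.
        have [_] := loc _ _ Ie Ie Qe Qe.
        by rewrite ler_norml => /andP[_]; lra.
    apply: (le_trans (kernel_mean_le x Bt h0 (measurableC mQ) EK0 mEK)).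
    rewrite lee_wpmul2l// lee_fin !mulr_ge0//; exact: ltW.
  rewrite mule1 -EFinM -EFinD lee_fin.
  have -> : (f x + ep) * ((1 + 2 * ep) * h) + F * L * h * ep =
     (f x + ep * (1 + 2 * f x + 2 * ep + F * L)) * h by ring.
  rewrite ler_pM2r// lerD2l (le_trans _ epc)// ler_pM2l// /c; move: ep1; lra.
(* When [f x] is not positive the lower bound is negative, hence trivial. *)
have [fp|fn] := ltP 0 (f x); last first.
  apply: (@le_trans _ _ 0%E); last by apply: integral_ge0 => w _; rewrite lee_fin.
  by rewrite lee_fin mulr_le0_ge0 ?(ltW h0)//; move: fn eta0; lra.
apply: (@le_trans _ _ (\int[P]_(w in Y @^-1` Q) (K (Y w))%:E)%E); last first.
  by rewrite intE leeDl//; apply: integral_ge0 => w _; rewrite lee_fin.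
have fep : 0 < f x - ep by have := epf fp; lra.
(* The inverse of the rescaled map: solve [(x - z) / h = u] for [z], then return to the noise by
   [chi t]. By the local estimate it shrinks distances by no more than the factor [h * (1 - ep)]. *)
pose rr u := chi t (x - h * u).
have xQ u : Q u -> I (x - h * u).
  move=> /QP Qu; apply: rI => //; rewrite addrAC subrr add0r normrN.
  exact: lt_le_trans dmr.
have xd u : Q u -> `|x - h * u - x| < dl.
  by move=> /QP Qu; rewrite addrAC subrr add0r normrN; exact: lt_le_trans dmdl.
have lb : (\int[lebesgue_measure]_(u in Q) (K u)%:E <=
   ((h * (1 - ep))^-1 / (f x - ep))%:E * \int[P]_(w in Y @^-1` Q) (K (Y w))%:E)%E.
  apply: (@density_transfer_ge _ _ _ _ _ _ _ (g x h t) Xf mI XI (mg x h Bt)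
    ((h * (1 - ep))^-1) (f x - ep) Q rr (EFin \o K)) => //.
  - by rewrite invr_gt0 mulr_gt0.
  - apply: (@measurable_comp _ _ _ _ _ _ I (chi t)) => //.
    + by move=> _ [u Qu <-]; exact: xQ.
    + exact: mchi.
    + by apply: measurable_funTS; apply: measurable_funB => //; exact: measurable_funM.
  - move=> u Qu; split; first by apply: chiI => //; exact: xQ.
    rewrite /g /rr chiK//; last exact: xQ.
    by rewrite opprB addrC subrK mulrAC divff ?mul1r// gt_eqF.
  - move=> e Ie Qe; rewrite /rr /g mulrC divfK ?gt_eqF// opprB addrC subrK psiK//.
  - move=> u u' Qu Qu'.
    have [H _] := locd t Bt tdl _ _ (xQ _ Qu) (xQ _ Qu') (xd _ Qu) (xd _ Qu').
    rewrite ler_pdivlMl ?mulr_gt0// /rr.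
    have e1 : `|x - h * u - (x - h * u')| = h * `|u - u'|.
      rewrite -(gtr0_norm h0) -normrM (gtr0_norm h0) distrC; congr `|_|; ring.
    rewrite e1 in H.
    have := lerB_dist (x - h * u - (x - h * u')) (rr u - rr u').
    rewrite e1 distrC -/(rr u) -/(rr u') in H *.
    by move=> H2; rewrite mulrAC mulrBr mulr1 lerBlDr; move: H H2; rewrite /rr; lra.
  - move=> e Ie Qe.
    have [_] := loc _ _ Ie Ie Qe Qe.
    by rewrite ler_norml => /andP[]; lra.
have := le_trans tail1 lb; rewrite -/Q => {lb}.
rewrite muleC -lee_pdivrMr ?invr_gt0 ?divr_gt0 ?invr_gt0 ?mulr_gt0//.
apply: le_trans.
rewrite -EFinM lee_fin invfM !invrK.
have -> : (1 - ep) * (h * (1 - ep) * (f x - ep)) =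
  (1 - ep) * (1 - ep) * (f x - ep) * h by ring.
rewrite ler_pM2r//.
have H1 : ep * (2 * f x) <= ep * c - ep.
  have -> : ep * c - ep = ep * (c - 1) by ring.
  by rewrite ler_pM2l// /c; have := mulr_gt0 F0 L0; lra.
have H2 : 0 <= ep * ep * (f x - ep) by rewrite !mulr_ge0// ltW.
have H3 : 0 <= ep * ep by rewrite mulr_ge0// ltW.
rewrite !(mulrBl, mulrBr) in H2 *.
by move: epc H1 H2 H3; lra.
Qed.

End kernel_mean.

(** * The projected gradient step *)

Lemma projection_contracts (R : realType) (a b x y : R) : a <= y <= b ->
  `|projection a b x - y| <= `|x - y|.
Proof.
move=> /andP[ay yb]; rewrite /projection; case: ifPn => [xa|]; last rewrite -ltNge => ax.
  by rewrite !ler0_norm; lra.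
by case: ifPn => // bx; rewrite !ger0_norm; lra.
Qed.

Lemma projection_itv (R : realType) (a b x : R) : a <= b ->
  a <= projection a b x <= b.
Proof.
move=> ab; rewrite /projection; case: ifPn => [_|]; first by rewrite lexx.
rewrite -ltNge => ax; case: ifPn => [_|]; rewrite ?lexx ?ab// -ltNge => xb.
by rewrite !ltW.
Qed.

Lemma measurable_projection (R : realType) (a b : R) :
  measurable_fun setT (projection a b).
Proof.
apply: measurable_fun_if => //; first exact: measurable_fun_ler.
apply: measurable_funTS; apply: measurable_fun_if => //.
exact: measurable_fun_ler.
Qed.

Section gradient.
Context d (T : measurableType d) (R : realType) (P : probability T R).
Variables (X : {RV P >-> R}) (I : set R) (Theta : set R) (a b theta : R).
Hypotheses (XI : forall w, I (X w)) (mI : measurable I).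
Hypotheses (ab : a < b) (ab_Theta : `[a, b] `<=` Theta) (theta_ab : a < theta < b).
Variable psi : R -> R -> R.
Let dpsi t e := derive_on Theta (psi ^~ e) t.
Hypotheses (psi_D : forall e, I e -> derivable_on Theta (psi ^~ e))
  (psi_C : forall e, I e -> {within Theta, continuous (psi ^~ e)})
  (dpsi_C : forall e, I e -> {within Theta, continuous (dpsi ^~ e)})
  (psi_theta : forall e, I e -> psi theta e = e)
  (mpsi : forall t, a <= t <= b -> measurable_fun I (psi t)).
Variable W : T -> \bar R.
Hypotheses (iW : P.-integrable setT W)
  (dpsiW : forall t w, a <= t <= b -> ((`|dpsi t (X w)| ^+ 4)%:E <= W w)%E).

Let inTheta t : a <= t <= b -> Theta t.
Proof. by move=> tab; apply: ab_Theta; rewrite /= in_itv. Qed.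

Let theta_in : a <= theta <= b.
Proof. by case/andP: theta_ab => ? ?; rewrite !ltW. Qed.

(** Dominated convergence and measurability of limits work along sequences. Moving from [t] towards
    an endpoint other than [t] keeps all increments nonzero and all points in [[a, b]], even if [t]
    is an endpoint. *)
Lemma ab_sequence t : a <= t <= b -> exists u : nat -> R,
  [/\ u n @[n --> \oo] --> 0, forall n, u n != 0 & forall n, a <= u n + t <= b].
Proof.
move=> /andP[at_ tb].
have [c [ct ac cb]] : exists c, [/\ c != t, a <= c & c <= b].
  have [->|ta] := eqVneq t a; first by exists b; rewrite gt_eqF// ltW.
  by exists a; rewrite eq_sym ta lexx ltW.
exists (fun n => (c - t) * n.+1%:R^-1); split.
- rewrite -(mulr0 (c - t)); apply: cvgMr; exact: cvg_harmonic.
- by move=> n; rewrite mulf_neq0 ?subr_eq0// invr_eq0 pnatr_eq0.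
- move=> n; have : 0 < n.+1%:R^-1 :> R by rewrite invr_gt0 ltr0n.
  have : n.+1%:R^-1 <= 1 :> R by rewrite invf_le1 ?ler1n ?ltr0n.
  move: (n.+1%:R^-1) => s s1 s0.
  have -> : (c - t) * s + t = s * c + (1 - s) * t by ring.
  by apply/andP; split; nra.
Qed.

Let quot_cvg t e u : a <= t <= b -> I e -> u n @[n --> \oo] --> 0 ->
  (forall n : nat, u n != 0) -> (forall n, a <= u n + t <= b) ->
  (u n)^-1 * (psi (u n + t) e - psi t e) @[n --> \oo] --> dpsi t e.
Proof.
move=> tab Ie u0 un uab.
have := @derive_on_cvg _ Theta (psi ^~ e) t _ _ _ u (psi_D Ie (inTheta tab)) u0; apply.
by apply: nearW => n; split => //; exact: inTheta.
Qed.

Lemma measurable_dpsi t : a <= t <= b -> measurable_fun I (dpsi t).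
Proof.
move=> tab; have [u [u0 un uab]] := ab_sequence tab.
apply: (@measurable_fun_cvg _ _ _ _ (fun n e => (u n)^-1 * (psi (u n + t) e - psi t e))).
  move=> n; apply: measurable_funM => //; apply: measurable_funB; exact: mpsi.
by move=> e Ie; exact: quot_cvg.
Qed.

(** Measurability in the pair is required because the random estimate will be substituted for the
    parameter. *)
Lemma measurable_psi2 : measurable_fun (`[a, b] `*` I) (fun p : R * R => psi p.1 p.2).
Proof.
apply: measurable_fun_caratheodory => //; first exact: ltW.
by move=> e Ie; apply: continuous_subspaceW (psi_C Ie).
Qed.

Lemma measurable_dpsi2 : measurable_fun (`[a, b] `*` I) (fun p : R * R => dpsi p.1 p.2).
Proof.
apply: measurable_fun_caratheodory => //; first exact: ltW.
  exact: measurable_dpsi.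
by move=> e Ie; apply: continuous_subspaceW (dpsi_C Ie).
Qed.

Let psi_MVT s t e : a <= s <= b -> a <= t <= b -> I e ->
  exists2 c, a <= c <= b & psi t e - psi s e = dpsi c e * (t - s).
Proof.
move=> sab tab Ie; wlog st : s t sab tab / s < t.
  move=> H; have [ts|st|->] := ltgtP t s; last by exists s => //; rewrite !subrr mulr0.
  - have [c cab E] := H _ _ tab sab ts.
    by exists c => //; rewrite -opprB E -mulrN opprB.
  - exact: H.
have stT : `[s, t] `<=` Theta.
  move=> x /=; rewrite in_itv/= => /andP[? ?]; apply: inTheta.
  by move: sab tab => /andP[? ?] /andP[? ?]; apply/andP; split; lra.
have [] := derive_on_MVT st stT _ _ (g := psi ^~ e).
- move=> c /andP[? ?]; apply: psi_D => //; apply: stT; rewrite /= in_itv/=.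
  by rewrite !ltW.
- exact: continuous_subspaceW (psi_C Ie).
move=> c /andP[? ?] E; exists c => //.
by move: sab tab => /andP[? ?] /andP[? ?]; apply/andP; split; lra.
Qed.

Let psi_sub t e : a <= t <= b -> I e ->
  exists2 c, a <= c <= b & psi t e - e = dpsi c e * (t - theta).
Proof.
move=> tab Ie; have [c cab E] := psi_MVT theta_in tab Ie.
by exists c; rewrite// -E psi_theta.
Qed.

Let W0 w : (0 <= W w)%E.
Proof. by apply: le_trans (dpsiW w theta_in); rewrite lee_fin exprn_ge0. Qed.

(** The squared product of two derivatives is at most the larger fourth power: this is how the
    fourth moment enters. *)
Let sqr_W s t w : a <= s <= b -> a <= t <= b ->
  (((dpsi s (X w) * dpsi t (X w)) ^+ 2)%:E <= W w)%E.
Proof.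
move=> sab tab.
apply: (@le_trans _ _
  (Num.max (`|dpsi s (X w)| ^+ 4) (`|dpsi t (X w)| ^+ 4))%:E); last first.
  by rewrite EFin_max ge_max !dpsiW.
rewrite lee_fin -real_normK ?num_real// normrM exprMn.
move: (`|dpsi s _|) (`|dpsi t _|)
  (normr_ge0 (dpsi s (X w))) (normr_ge0 (dpsi t (X w))) => u v u0 v0.
have E4 (z : R) : z ^+ 4 = z ^+ 2 * z ^+ 2 by rewrite -exprD.
rewrite !E4; have [uv|vu] := leP u v.
  rewrite le_max; apply/orP; right.
  by rewrite ler_wpM2r ?exprn_ge0// lerXn2r.
rewrite le_max; apply/orP; left.
by rewrite ler_wpM2l ?exprn_ge0// lerXn2r// ?nnegrE// ltW.
Qed.

Let prod_W s t w : a <= s <= b -> a <= t <= b ->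
  (`|dpsi s (X w) * dpsi t (X w)|%:E <= 1 + W w)%E.
Proof.
move=> sab tab; apply: le_trans (leeD2l _ (sqr_W w sab tab)).
rewrite -EFinD lee_fin -[X in _ <= _ + X]real_normK ?num_real//.
move: (`|_ * _|) (normr_ge0 (dpsi s (X w) * dpsi t (X w))) => u u0; nra.
Qed.

Let iW1 (c : R) : P.-integrable setT (fun w => (c%:E * (1 + W w))%E).
Proof.
apply: integrableZl => //; apply: integrableD => //.
exact: (finite_measure_integrable_cst _ 1).
Qed.

Let integrable_W (g : T -> R) (c : R) : measurable_fun setT g ->
  (forall w, (`|g w|%:E <= c%:E * (1 + W w))%E) -> P.-integrable setT (EFin \o g).
Proof.
move=> mg gW; apply: (le_integrable _ _ _ (iW1 c)) => //; first exact/measurable_EFinP.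
by move=> w _ /=; rewrite (le_trans (gW w))// lee_abs.
Qed.

Let mX (g : R -> R) : measurable_fun I g -> measurable_fun setT (fun w => g (X w)).
Proof.
move=> mg; apply: (@measurable_comp _ _ _ _ _ _ I g _ X) => //.
by move=> _ [w _ <-]; exact: XI.
Qed.

Let grad t e := - 2 * dpsi t e * (e - psi t e).

(** The mean value theorem from [theta], where [psi] is the identity, extracts the factor
    [t - theta]. The point [c] depends on [e], which is why bounds go through the supremum [W]. *)
Lemma grad_factor t e : a <= t <= b -> I e ->
  exists2 c, a <= c <= b & grad t e = 2 * (t - theta) * (dpsi t e * dpsi c e).
Proof.
move=> tab Ie; have [c cab E] := psi_sub tab Ie; exists c => //.
by rewrite /grad -opprB E; ring.
Qed.

Lemma measurable_grad t : a <= t <= b -> measurable_fun I (grad t).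
Proof.
move=> tab; apply: measurable_funM.
  by apply: measurable_funM => //; exact: measurable_dpsi.
by apply: measurable_funB => //; exact: mpsi.
Qed.

Let w0 : R := fine (\int[P]_w W w)%E.

Lemma mean_bound_ge0 : 0 <= w0.
Proof. by apply: fine_ge0; exact: integral_ge0. Qed.

Lemma grad_sqr t : a <= t <= b ->
  (\int[P]_w ((grad t (X w)) ^+ 2)%:E <= (4 * w0 * (t - theta) ^+ 2)%:E)%E.
Proof.
move=> tab.
have mg := mX (measurable_grad tab).
apply: (@le_trans _ _ (\int[P]_w ((4 * (t - theta) ^+ 2)%:E * W w))%E).
  apply: ge0_le_integral => //.
  - by move=> w _; rewrite lee_fin sqr_ge0.
  - by apply/measurable_EFinP; exact: measurable_funX.
  - by apply: measurable_funeM; exact: (measurable_int P iW).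
  - move=> w _; have [c cab ->] := grad_factor tab (XI w).
    have -> : (2 * (t - theta) * (dpsi t (X w) * dpsi c (X w))) ^+ 2 =
       4 * (t - theta) ^+ 2 * (dpsi t (X w) * dpsi c (X w)) ^+ 2 by ring.
    by rewrite EFinM lee_wpmul2l ?lee_fin ?sqr_W// mulr_ge0// sqr_ge0.
rewrite integralZl//.
have /fineK <- := integrable_fin_num measurableT iW.
by rewrite -/w0 -EFinM lee_fin mulrAC.
Qed.

Lemma integrable_grad t : a <= t <= b -> P.-integrable setT (fun w => (grad t (X w))%:E).
Proof.
move=> tab; apply: (@integrable_W _ (2 * `|t - theta|)).
  exact: mX (measurable_grad tab).
move=> w; have [c cab ->] := grad_factor tab (XI w).
rewrite normrM EFinM normrM (ger0_norm (ler0n _ 2)) lee_wpmul2l ?prod_W//.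
Qed.

Lemma integrable_grad2 t : a <= t <= b ->
  P.-integrable setT (fun w => (grad t (X w) ^+ 2)%:E).
Proof.
move=> tab; apply: (@integrable_W _ (4 * (t - theta) ^+ 2)).
  by apply: measurable_funX; exact: mX (measurable_grad tab).
move=> w; rewrite ger0_norm ?sqr_ge0//; have [c cab ->] := grad_factor tab (XI w).
have -> : (2 * (t - theta) * (dpsi t (X w) * dpsi c (X w))) ^+ 2 =
  4 * (t - theta) ^+ 2 * (dpsi t (X w) * dpsi c (X w)) ^+ 2 by ring.
rewrite EFinM lee_wpmul2l//; first by rewrite lee_fin mulr_ge0// sqr_ge0.
by apply: (le_trans (sqr_W w tab cab)); rewrite leeDr.
Qed.


Let sq t w := `|psi t (X w) - X w| ^+ 2.

Let integrable_sq t : a <= t <= b -> P.-integrable setT (fun w => (sq t w)%:E).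
Proof.
move=> tab; apply: (@integrable_W _ ((t - theta) ^+ 2)).
  apply: measurable_funX; apply: measurableT_comp => //.
  by apply: measurable_funB => //; exact: mX (mpsi tab).
move=> w; have [c cab E] := psi_sub tab (XI w).
rewrite /sq E real_normK ?num_real// exprMn.
rewrite ger0_norm; last by apply: mulr_ge0; exact: sqr_ge0.
rewrite mulrC EFinM lee_wpmul2l//; first by rewrite lee_fin sqr_ge0.
by have := prod_W w cab cab; rewrite -expr2 ger0_norm ?sqr_ge0.
Qed.

Let M t : R := fine 'E_P[fun w => sq t w].

Let ME t : a <= t <= b -> (\int[P]_w (sq t w)%:E = (M t)%:E)%E.
Proof.
move=> tab; rewrite /M unlock fineK//.
exact: integrable_fin_num (integrable_sq tab).
Qed.

(** Differentiation under the expectation, by dominated convergence along one sequence of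
    increments; the assumed limit of the difference quotients of [M] must then be the integral. *)
Lemma derive_mean_sq t : a <= t <= b -> cvg (diff_quotient_on Theta M t) ->
  (\int[P]_w (grad t (X w))%:E = (derive_on Theta M t)%:E)%E.
Proof.
move=> tab cg; have [u [u0 un uab]] := ab_sequence tab.
have uA : \forall n \near \oo, u n != 0 /\ Theta (u n + t).
  by apply: nearW => n; split => //; exact: inTheta.
have HM := @derive_on_cvg _ Theta M t _ _ _ u cg u0 uA.
pose q n w := (u n)^-1 * (sq (u n + t) w - sq t w).
have qE n : (\int[P]_w (q n w)%:E = ((u n)^-1 * (M (u n + t) - M t))%:E)%E.
  rewrite EFinM EFinB -!ME// -integralB//; [|exact: integrable_sq..].
  rewrite -integralZl//; apply: integrableB => //; exact: integrable_sq.
have mq n : measurable_fun setT (q n).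
  apply: measurable_funM => //; apply: measurable_funB;
  by apply/measurable_EFinP; apply: (measurable_int P); exact: integrable_sq.
have qfact n w : q n w = ((u n)^-1 * (psi (u n + t) (X w) - psi t (X w))) *
    (psi (u n + t) (X w) - X w + (psi t (X w) - X w)).
  by rewrite /q /sq !real_normK ?num_real//; ring.
(* Three mean value points turn the factored quotient into two products of derivatives, each with a
   weight at most [b - a]; [1 + W] dominates each product. *)
have qb n w : (`|(q n w)%:E| <= (2 * (b - a))%:E * (1 + W w))%E.
  have [c cab Ec] := psi_MVT tab (uab n) (XI w).
  have [c1 c1ab E1] := psi_sub (uab n) (XI w).
  have [c2 c2ab E2] := psi_sub tab (XI w).
  rewrite /= qfact Ec E1 E2 addrK.
  have -> : (u n)^-1 * (dpsi c (X w) * u n) = dpsi c (X w).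
    by rewrite mulrCA mulVf ?mulr1.
  have bnd s : a <= s <= b -> `|s - theta| <= b - a.
    move=> sab; rewrite ler_norml; move: sab theta_in => /andP[? ?] /andP[? ?].
    by apply/andP; split; lra.
  have p1 := prod_W w cab c1ab; have p2 := prod_W w cab c2ab.
  apply: (@le_trans _ _ ((b - a)%:E * `|dpsi c (X w) * dpsi c1 (X w)|%:E +
      (b - a)%:E * `|dpsi c (X w) * dpsi c2 (X w)|%:E)%E).
    rewrite -!EFinM -EFinD lee_fin mulrDr (le_trans (ler_normD _ _))// !mulrA.
    by rewrite 2!(mulrC (b - a)) lerD// normrM ler_wpM2l// bnd.
  have -> : (2 * (b - a))%:E = ((b - a)%:E + (b - a)%:E)%E.
    by rewrite -EFinD; congr EFin; ring.
  have ba : 0 <= b - a by rewrite subr_ge0 ltW.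
  by rewrite ge0_muleDl ?lee_fin//; apply: leeD; apply: lee_wpmul2l.
have qc w : q n w @[n --> \oo] --> grad t (X w).
  rewrite (_ : q ^~ w = fun n => ((u n)^-1 * (psi (u n + t) (X w) - psi t (X w))) *
    (psi (u n + t) (X w) - X w + (psi t (X w) - X w))); last first.
    by apply/funext => n; exact: qfact.
  rewrite (_ : grad t (X w) =
    dpsi t (X w) * (psi t (X w) - X w + (psi t (X w) - X w))); last first.
    by rewrite /grad; ring.
  apply: cvgM; first exact: quot_cvg.
  apply: cvgD; last exact: cvg_cst.
  apply: cvgB; last exact: cvg_cst.
  have ut : u n + t @[n --> \oo] --> t.
    by rewrite -[X in _ --> X]add0r; apply: cvgD => //; exact: cvg_cst.
  apply: (within_continuous_cvg (psi_C (XI w)) (inTheta tab) ut).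
  by apply: nearW => n; exact: inTheta.
have qcE w : (q n w)%:E @[n --> \oo] --> (grad t (X w))%:E.
  by apply: cvg_EFin; [exact: nearW|exact: qc].
have [_ _] := @dominated_convergence _ _ _ P setT measurableT (fun n w => (q n w)%:E)
  (fun w => (grad t (X w))%:E) (fun w => (2 * (b - a))%:E * (1 + W w))%E
  (fun n => (measurable_EFinP _ _).2 (mq n))
  ((measurable_EFinP _ _).2 (mX (measurable_grad tab)))
  (aeW P (fun w _ => qcE w))
  (iW1 _) (aeW P (fun w n _ => qb n w)).
rewrite (_ : [sequence _]_n = fun n => ((u n)^-1 * (M (u n + t) - M t))%:E); last first.
  by apply/funext => n /=; exact: qE.
move=> H; apply: cvg_unique H _; first exact: ereal_hausdorff.
apply: cvg_EFin; first exact: nearW.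
exact: HM.
Qed.

Hypothesis dM_sign : forall t, a <= t <= b -> t != theta ->
  0 < (t - theta) * derive_on Theta M t.
Hypothesis d2M_ge : forall t, a <= t <= b ->
  2^-1 <= derive_on Theta (derive_on Theta M) t.

(* At [theta] no differentiability is needed: both sides vanish, the derivative
   either truly or by default. *)
Lemma derive_mean_sqE t : a <= t <= b ->
  (\int[P]_w (grad t (X w))%:E = (derive_on Theta M t)%:E)%E.
Proof.
move=> tab; have [cg|ncg] := pselect (cvg (diff_quotient_on Theta M t)).
  exact: derive_mean_sq.
have dM0 : derive_on Theta M t = 0.
  by apply/eqP; apply: contra_notT ncg => /derive_on_neq0.
have tE : t = theta.
  apply/eqP; apply: contraPT dM0 => /(dM_sign tab) + dM0.
  by rewrite dM0 mulr0 ltxx.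
rewrite dM0 tE; under eq_integral do rewrite /grad psi_theta// subrr mulr0.
exact: integral0.
Qed.

Let dM_theta : derive_on Theta M theta = 0.
Proof.
apply: EFin_inj; rewrite -derive_mean_sqE//.
under eq_integral do rewrite /grad psi_theta// subrr mulr0.
exact: integral0.
Qed.

Lemma derive_mean_sq_growth t : a <= t <= b ->
  2^-1 * (t - theta) ^+ 2 <= (t - theta) * derive_on Theta M t.
Proof.
pose dM := derive_on Theta M.
(* A divergent quotient would give the default value [0], so the bound [2^-1] itself proves that the
   derivative of [dM] exists. *)
have d2 s : a <= s <= b -> cvg (diff_quotient_on Theta dM s).
  move=> sab; apply: derive_on_neq0; rewrite gt_eqF//.
  by apply: lt_le_trans (d2M_ge sab); rewrite invr_gt0.
have mono s r : a <= s <= b -> a <= r <= b -> s < r -> 2^-1 * (r - s) <= dM r - dM s.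
  move=> sab rab sr.
  have srab x : s <= x <= r -> a <= x <= b.
    by move: sab rab => /andP[? ?] /andP[? ?] /andP[? ?]; apply/andP; split; lra.
  have srT : `[s, r] `<=` Theta.
    by move=> x /=; rewrite in_itv/= => /srab; exact: inTheta.
  have [] := derive_on_MVT sr srT _ _ (g := dM).
  - by move=> c /andP[? ?]; apply: d2; apply: srab; rewrite !ltW.
  - apply/subspace_continuousP => x /= xsr.
    rewrite in_itv/= in xsr.
    have xab := srab _ xsr.
    apply: cvg_trans (derivable_on_within_continuous (inTheta xab) (d2 _ xab)).
    by apply: cvg_app; exact: within_subset.
  move=> c /andP[? ?] ->; rewrite ler_wpM2r//; first by rewrite subr_ge0 ltW.
  by apply: d2M_ge; apply: srab; rewrite !ltW.
move=> tab; have [tt|tt|->] := ltgtP t theta.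
- have := mono _ _ tab theta_in tt; rewrite {1}/dM dM_theta -/dM => H.
  by rewrite expr2 -/dM; move: H tt; move: (dM t) => D H tt; nra.
- have := mono _ _ theta_in tab tt; rewrite /dM dM_theta -/dM => H.
  by rewrite expr2 -/dM; move: H tt; move: (dM t) => D H tt; nra.
- by rewrite subrr expr0n/= mulr0 mul0r.
Qed.

(** The projection does not increase the distance to [theta]. Expanding the square, the cross term
    contributes at most [- g] by [derive_mean_sq_growth], and the last term at most
    [4 * w0 * g ^+ 2] by [grad_sqr], both times [(t - theta) ^+ 2]. *)
Lemma gradient_step_contracts t g : a <= t <= b -> 0 <= g ->
  (\int[P]_w ((projection a b (t - g * grad t (X w)) - theta) ^+ 2)%:E <=
   ((1 - g + 4 * w0 * g ^+ 2) * (t - theta) ^+ 2)%:E)%E.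
Proof.
move=> tab g0.
have ig := integrable_grad tab; have ig2 := integrable_grad2 tab.
have mg : measurable_fun setT (fun w => grad t (X w)) := mX (measurable_grad tab).
apply: (@le_trans _ _ (\int[P]_w (((t - theta) ^+ 2)%:E +
   ((- 2 * g * (t - theta))%:E * (grad t (X w))%:E +
     (g ^+ 2)%:E * (grad t (X w) ^+ 2)%:E)))%E).
  have E w : ((t - theta) ^+ 2 + (- 2 * g * (t - theta) * grad t (X w) +
      g ^+ 2 * grad t (X w) ^+ 2)) = (t - g * grad t (X w) - theta) ^+ 2 by ring.
  apply: ge0_le_integral => //.
  - by move=> w _; rewrite lee_fin sqr_ge0.
  - apply/measurable_EFinP; apply: measurable_funX; apply: measurable_funB => //.
    apply: measurableT_comp; first exact: measurable_projection.
    by apply: measurable_funB => //; exact: measurable_funM.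
  - by apply/measurable_EFinP; apply: measurable_funD => //; apply: measurable_funD;
      apply: measurable_funM => //; exact: measurable_funX.
  - move=> w _; rewrite -!EFinM -!EFinD lee_fin E.
    rewrite -ler_sqrt ?sqr_ge0// !sqrtr_sqr; exact: projection_contracts.
have ic : P.-integrable setT (fun w : T => ((t - theta) ^+ 2)%:E).
  exact: (finite_measure_integrable_cst _ ((t - theta) ^+ 2)).
rewrite integralD//; last by apply: integrableD => //; exact: integrableZl.
rewrite integralD//; [|exact: integrableZl..].
have -> : (\int[P]_w ((t - theta) ^+ 2)%:E = ((t - theta) ^+ 2)%:E)%E.
  by have := expectation_cst P ((t - theta) ^+ 2); rewrite unlock.
rewrite !integralZl// derive_mean_sqE//.
have := grad_sqr tab.
have /fineK <- := integrable_fin_num measurableT ig2.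
move: (fine _) => r; rewrite -!EFinM -!EFinD !lee_fin => H.
have H1 := derive_mean_sq_growth tab.
have H2 : g ^+ 2 * r <= g ^+ 2 * (4 * w0 * (t - theta) ^+ 2).
  by rewrite ler_wpM2l// sqr_ge0.
have H3 : g * (2^-1 * (t - theta) ^+ 2) <= g * ((t - theta) * derive_on Theta M t).
  by rewrite ler_wpM2l.
move: H2 H3; lra.
Qed.

End gradient.

(** * Passing from the noise to the reconstructed noise *)

Lemma within_continuous_dist (R : realType) (A : set R) (g : R -> R) (x e : R) :
  {within A, continuous g} -> A x -> 0 < e -> exists2 delta : R, 0 < delta &
  forall y, A y -> `|y - x| < delta -> `|g y - g x| < e.
Proof.
move=> /subspace_continuousP gA Ax e0.
have /cvgrPdist_lt/(_ _ e0) := gA _ Ax.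
rewrite near_withinE => /nbhs_ballP[dl /= dl0 H]; exists dl => // y Ay yx.
by rewrite distrC; apply: H => //; rewrite /ball/= distrC.
Qed.

Lemma within_continuous_dist2 (R : realType) (A B : set R) (g : R * R -> R) (x y e : R) :
  {within A `*` B, continuous g} -> A x -> B y -> 0 < e ->
  exists2 delta : R, 0 < delta &
  forall x' y', A x' -> B y' -> `|x' - x| < delta -> `|y' - y| < delta ->
  `|g (x', y') - g (x, y)| < e.
Proof.
move=> /subspace_continuousP gA Ax By e0.
have /cvgrPdist_lt/(_ _ e0) := gA (x, y) (conj Ax By).
rewrite near_withinE => /nbhs_ballP[dl /= dl0 H].
exists dl => // x' y' Ax' By' xx yy.
by rewrite distrC; apply: H => //; split; rewrite /ball/= distrC.
Qed.

Lemma bounded_exists (S : Type) (R : realType) (g : S -> R) (A : set S) :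
  [bounded g x | x in A] ->
  exists2 C : R, 0 < C & forall x, A x -> `|g x| <= C.
Proof.
move=> [M0 [_ H]]; exists (Num.max 1 (M0 + 1)); first by rewrite lt_max ltr01.
by move=> x Ax; apply: (H (Num.max 1 (M0 + 1))) => //; rewrite lt_max ltrDl ltr01 orbT.
Qed.

(** The points of [I] where [g] is at least a given level form an interval. *)
Lemma increasing_measurable_itv (R : realType) (I : set R) (g : R -> R) :
  is_interval I -> (forall x y, I x -> I y -> x < y -> g x < g y) ->
  measurable_fun I g.
Proof.
move=> I_itv g_incr.
apply: (measurability (@RGenCInfty.G R)) => [|/= _ [_] [r] -> <-].
  exact: RGenCInfty.measurableE.
apply: is_interval_measurable => s t [Is] /=.
rewrite !in_itv/= !andbT => gs [It gt] u /andP[su ut].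
have Iu : I u by apply: (I_itv _ _ Is It); rewrite su.
split=> //=; rewrite in_itv/= andbT (le_trans gs)//.
by move: su; rewrite [s <= u]le_eqVlt => /predU1P[-> //|su]; apply: ltW; exact: g_incr.
Qed.

Section density.
Context d (T : measurableType d) (R : realType) (P : probability T R).
Variables (X : {RV P >-> R}) (f : R -> R) (I : set R).
Hypotheses (Xf : is_density X f) (I_itv : is_interval I) (XI : forall w, I (X w)).

(** Were [x] not interior to [I], continuity would make the density positive on a set of positive
    length outside [I], which [X] never visits. *)
Lemma density_pos_interior x : I x -> {for x, continuous f} -> 0 < f x ->
  exists2 r : R, 0 < r & forall z, `|z - x| < r -> I z.
Proof.
move=> Ix cf fx0.
have [r /= r0 fr] : \forall z \near x, f x / 2 < f z.
  by apply: cvgr_gt cf _ _; lra.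
exists r => // z zx; apply: contrapT => nIz.
have [mf f0 fP] := Xf.
(* [J] lies beyond [z], away from [x]: since [I] is an interval containing [x] but not [z], it
   cannot reach past [z]. *)
have [J [mJ J0 JI Jr]] : exists J : set R, [/\ measurable J,
    (0 < lebesgue_measure J)%E, J `<=` ~` I & forall y, J y -> `|y - x| < r].
  have [zx'|xz|zx'] := ltgtP z x; last by rewrite zx' in nIz.
  - exists `]x - r, z]%classic; split.
    + exact: measurable_itv.
    + rewrite lebesgue_measure_itv/= lte_fin ifT ?lte_fin ?subr_gt0; last first.
        by move: zx; rewrite ltr_norml; lra.
      by move: zx; rewrite ltr_norml; lra.
    + move=> y; rewrite /= in_itv/= => /andP[_ yz] Iy; apply: nIz.
      by apply: (I_itv Iy Ix); rewrite yz ltW.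
    + by move=> y; rewrite /= in_itv/= => /andP[? ?]; rewrite ltr_norml; lra.
  - exists `[z, x + r[%classic; split.
    + exact: measurable_itv.
    + rewrite lebesgue_measure_itv/= lte_fin ifT ?lte_fin ?subr_gt0; last first.
        by move: zx; rewrite ltr_norml; lra.
      by move: zx; rewrite ltr_norml; lra.
    + move=> y; rewrite /= in_itv/= => /andP[zy _] Iy; apply: nIz.
      by apply: (I_itv Ix Iy); rewrite zy ltW.
    + by move=> y; rewrite /= in_itv/= => /andP[? ?]; rewrite ltr_norml; lra.
have PJ : distribution P X J = 0%E.
  rewrite /distribution /pushforward (_ : X @^-1` J = set0) ?measure0//.
  by apply/seteqP; split => w //= /JI; apply; exact: XI.
suff : (0 < distribution P X J)%E by rewrite PJ ltxx.
rewrite fP//; apply: (@lt_le_trans _ _ (\int[lebesgue_measure]_(y in J) (f x / 2)%:E)%E).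
  by rewrite integral_cst// mule_gt0// lte_fin divr_gt0.
apply: ge0_le_integral => //.
- by move=> y _; rewrite lee_fin divr_ge0// ltW.
- by apply/measurable_EFinP; exact: measurable_funTS.
- by move=> y Jy; rewrite lee_fin ltW//; apply: fr; rewrite /ball_/= distrC; exact: Jr.
Qed.

(** A singleton is Lebesgue null, so it cannot carry a law with a density. This excludes an [I]
    reduced to [x], where derivatives relative to [I] carry no information. *)
Lemma density_support_nontrivial x : exists2 y, I y & y != x.
Proof.
apply: contrapT => H.
have E : distribution P X [set x] = 1%E.
  rewrite /distribution /pushforward (_ : X @^-1` _ = setT) ?probability_setT//.
  apply/seteqP; split => w //= _; apply/eqP; apply: contrapT => /negP Xx.
  by apply: H; exists (X w).
have [_ _ fP] := Xf.
move: E; rewrite fP// integral_set1 => /eqP.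
by rewrite eq_sym onee_eq0.
Qed.

End density.

Section change_of_parameter.
Context (R : realType).
Variables (Theta I1 I2 : set R) (phi : R -> R -> R) (theta : R).
Hypotheses (theta_Theta : Theta theta) (I1_itv : is_interval I1).
Hypotheses (phi_bij : forall t, Theta t -> set_bij I1 I2 (phi t))
  (phi_incr : forall t, Theta t ->
    forall x y, I1 x -> I1 y -> x < y -> phi t x < phi t y).

Let inv t := phi_inv I1 phi t.

Lemma phi_in t e : Theta t -> I1 e -> I2 (phi t e).
Proof. by move=> Tt Ie; have [H _ _] := phi_bij Tt; exact: H. Qed.

Lemma phi_inv_in t y : Theta t -> I2 y -> I1 (inv t y) /\ phi t (inv t y) = y.
Proof.
move=> Tt Iy; have [_ inj /(_ _ Iy)[e Ie <-]] := phi_bij Tt.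
by rewrite /inv /phi_inv pinvKV ?inE.
Qed.

Lemma phi_invK t e : Theta t -> I1 e -> inv t (phi t e) = e.
Proof.
by move=> Tt Ie; have [_ inj _] := phi_bij Tt; rewrite /inv /phi_inv pinvKV ?inE.
Qed.

(* The paper's [Z_n(t)] is [to_noise t (eps n)]. *)
Definition to_noise t e := phi_inv I1 phi t (phi theta e).
Definition of_noise t z := phi_inv I1 phi theta (phi t z).

Lemma to_noise_in t e : Theta t -> I1 e -> I1 (to_noise t e).
Proof. by move=> Tt Ie; have [] := phi_inv_in Tt (phi_in theta_Theta Ie). Qed.

Lemma of_noise_in t e : Theta t -> I1 e -> I1 (of_noise t e).
Proof. by move=> Tt Ie; have [] := phi_inv_in theta_Theta (phi_in Tt Ie). Qed.

Lemma to_noiseK t e : Theta t -> I1 e -> of_noise t (to_noise t e) = e.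
Proof.
move=> Tt Ie; rewrite /of_noise /to_noise.
by have [_ ->] := phi_inv_in Tt (phi_in theta_Theta Ie); exact: phi_invK.
Qed.

Lemma of_noiseK t e : Theta t -> I1 e -> to_noise t (of_noise t e) = e.
Proof.
move=> Tt Ie; rewrite /of_noise /to_noise.
by have [_ ->] := phi_inv_in theta_Theta (phi_in Tt Ie); exact: phi_invK.
Qed.

Lemma to_noise_theta e : I1 e -> to_noise theta e = e.
Proof. by move=> Ie; exact: phi_invK. Qed.

Let inv_incr t y y' : Theta t -> I2 y -> I2 y' -> y < y' -> inv t y < inv t y'.
Proof.
move=> Tt Iy Iy' yy.
have [Ii pi] := phi_inv_in Tt Iy; have [Ii' pi'] := phi_inv_in Tt Iy'.
rewrite ltNge; apply/negP; rewrite le_eqVlt => /predU1P[E|/(phi_incr Tt Ii' Ii)].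
  by move: yy; rewrite -pi -pi' E ltxx.
by rewrite pi pi' => /(lt_trans yy); rewrite ltxx.
Qed.

Lemma measurable_to_noise t : Theta t -> measurable_fun I1 (to_noise t).
Proof.
move=> Tt; apply: increasing_measurable_itv => // x y Ix Iy xy.
by apply: inv_incr => //; [exact: phi_in|exact: phi_in|exact: phi_incr].
Qed.

Lemma measurable_of_noise t : Theta t -> measurable_fun I1 (of_noise t).
Proof.
move=> Tt; apply: increasing_measurable_itv => // x y Ix Iy xy.
by apply: inv_incr => //; [exact: phi_in|exact: phi_in|exact: phi_incr].
Qed.

Hypothesis phi_D : forall t, Theta t ->
  {within I1, continuous (phi t)} /\ derivable_on I1 (phi t).
Hypothesis inv_C1 : Ck_on 1 I2 (phi_inv I1 phi theta).
Variable C : R.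
Hypotheses (C0 : 0 < C)
  (dphi_C : forall t z, Theta t -> I1 z -> `|derive_on I1 (phi t) z| <= C)
  (dinv_C : forall y, I2 y -> `|derive_on I2 (phi_inv I1 phi theta) y| <= C).

(** [I2] is the continuous image of an interval; the mean value theorem for the inverse map needs
    this. *)
Let I2_itv : is_interval I2.
Proof.
apply/connected_intervalP.
have -> : I2 = [set phi theta x | x in I1].
  have [H _ S] := phi_bij theta_Theta.
  by apply/seteqP; split=> [y /S//|_ [e Ie <-]]; exact: H.
apply: connected_continuous_connected; first exact/connected_intervalP.
by have [] := phi_D theta_Theta.
Qed.

(** In place of a chain rule, the mean value theorem is used once for [phi t] and once for the
    inverse of [phi theta], each with its own intermediate point. *)
Let of_noise_MVT t z z' : Theta t -> I1 z -> I1 z' -> z < z' -> exists c y,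
  [/\ z < c < z', phi t z < y < phi t z' &
  of_noise t z' - of_noise t z =
  derive_on I2 (inv theta) y * derive_on I1 (phi t) c * (z' - z)].
Proof.
move=> Tt Iz Iz' zz'.
have [cphi dphi] := phi_D Tt; have [cinv [dinv _]] := inv_C1.
have zzI : `[z, z'] `<=` I1 by move=> x /=; rewrite in_itv/=; exact: (I1_itv Iz Iz').
have pp := phi_incr Tt Iz Iz' zz'.
have ppI : `[phi t z, phi t z'] `<=` I2.
  by move=> y /=; rewrite in_itv/=; apply: I2_itv; exact: phi_in.
have [] := derive_on_MVT zz' zzI _ _ (g := phi t).
- by move=> c /andP[? ?]; apply: dphi; apply: zzI; rewrite /= in_itv/= !ltW.
- exact: continuous_subspaceW cphi.
move=> c cz Ec.
have [] := derive_on_MVT pp ppI _ _ (g := inv theta).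
- by move=> y /andP[? ?]; apply: dinv; apply: ppI; rewrite /= in_itv/= !ltW.
- exact: continuous_subspaceW cinv.
move=> y yz Ey; exists c, y; split => //.
by rewrite /of_noise -/(inv theta) Ey Ec mulrA.
Qed.

Lemma of_noise_lipschitz t z z' : Theta t -> I1 z -> I1 z' ->
  `|of_noise t z - of_noise t z'| <= C * C * `|z - z'|.
Proof.
move=> Tt Iz Iz'; wlog zz : z z' Iz Iz' / z < z'.
  move=> H; have [zz|zz|->] := ltgtP z z'; last by rewrite !subrr normr0 mulr0.
  - exact: H.
  - by rewrite distrC [X in _ <= _ * X]distrC; exact: H.
have [c [y [/andP[zc cz] /andP[py yp] E]]] := of_noise_MVT Tt Iz Iz' zz.
rewrite distrC E [X in _ <= _ * X]distrC !normrM ler_wpM2r// ler_pM//.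
  by apply: dinv_C; apply: (I2_itv (phi_in Tt Iz) (phi_in Tt Iz')); rewrite !ltW.
by apply: dphi_C => //; apply: (I1_itv Iz Iz'); rewrite !ltW.
Qed.

Hypothesis phi_cont : {within Theta `*` I1, continuous (fun p : R * R => phi p.1 p.2)}.
Hypothesis dphi_cont :
  {within Theta `*` I1, continuous (fun p : R * R => derive_on I1 (phi p.1) p.2)}.
Variable x : R.
Hypotheses (Ix : I1 x) (I1_nontrivial : exists2 y, I1 y & y != x).

Let slope := derive_on I2 (inv theta) (phi theta x) * derive_on I1 (phi theta) x.

Let of_noise_slope (e : R) : 0 < e -> exists2 delta : R, 0 < delta &
  forall t z z', Theta t -> `|t - theta| < delta -> I1 z -> I1 z' ->
  `|z - x| < delta -> `|z' - x| < delta -> z < z' ->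
  `|of_noise t z' - of_noise t z - slope * (z' - z)| <= e * (z' - z).
Proof.
move=> e0.
(* Half of [e] goes to the variation of each derivative in the product, the other factor being
   bounded by [C]. *)
have e1 : 0 < e / (2 * C) by rewrite divr_gt0// mulr_gt0.
have Iy : I2 (phi theta x) by exact: phi_in.
have [_ [_ [cdinv _]]] := inv_C1.
have [d1 d10 H1] := within_continuous_dist cdinv Iy e1.
have [d2 d20 H2] := within_continuous_dist2 phi_cont theta_Theta Ix d10.
have [d3 d30 H3] := within_continuous_dist2 dphi_cont theta_Theta Ix e1.
exists (Num.min d2 d3); first by rewrite lt_min d20.
move=> t z z' Tt; rewrite !lt_min => /andP[t2 t3] Iz Iz' /andP[z2 z3] /andP[z2' z3'] zz.
have [c [y [/andP[zc cz] /andP[py yp] E]]] := of_noise_MVT Tt Iz Iz' zz.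
have Ic : I1 c by apply: (I1_itv Iz Iz'); rewrite !ltW.
have Iyy : I2 y by apply: (I2_itv (phi_in Tt Iz) (phi_in Tt Iz')); rewrite !ltW.
have c3 : `|c - x| < d3 by move: z3 z3'; rewrite !ltr_norml => /andP[? ?] /andP[? ?]; lra.
have y1 : `|y - phi theta x| < d1.
  have := H2 _ _ Tt Iz t2 z2; have := H2 _ _ Tt Iz' t2 z2'.
  by rewrite /= !ltr_norml => /andP[? ?] /andP[? ?]; lra.
rewrite E -mulrBl normrM [X in _ * X]gtr0_norm ?subr_gt0//.
rewrite ler_wpM2r ?subr_ge0 ?(ltW zz)//.
have B1 := H1 _ Iyy y1; have B2 := H3 _ _ Tt Ic t3 c3.
rewrite /slope; set D := derive_on I2 _ _ in B1 *; set D0 := derive_on I2 _ _ in B1 *.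
rewrite /= in B2; set G := derive_on I1 _ _ in B2 *; set G0 := derive_on I1 _ _ in B2 *.
have -> : D * G - D0 * G0 = (D - D0) * G + D0 * (G - G0) by ring.
apply: (le_trans (ler_normD _ _)); rewrite !normrM.
have -> : e = e / (2 * C) * C + C * (e / (2 * C)).
  by field; rewrite gt_eqF.
by apply: lerD; apply: ler_pM => //; [exact: ltW|exact: dphi_C|exact: dinv_C|exact: ltW].
Qed.

(* For [t = theta] the map is the identity. *)
Let slope1 : slope = 1.
Proof.
apply/eqP; rewrite -subr_eq0 -normr_le0; apply/ler_addgt0Pr => e e0; rewrite add0r.
have [dl dl0 H] := of_noise_slope e0.
have [y Iy yx] := I1_nontrivial.
have yx0 : 0 < `|y - x| by rewrite normr_gt0 subr_eq0.
pose s := Num.min 1 (dl / (2 * `|y - x|)).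
have s0 : 0 < s by rewrite lt_min ltr01 divr_gt0// mulr_gt0.
have s1 : s <= 1 by rewrite ge_min lexx.
have sd : s * `|y - x| < dl.
  rewrite (@le_lt_trans _ _ (dl / 2))//; last by lra.
  rewrite -ler_pdivlMr// -mulrA -invfM ge_min lexx orbT//.
(* A point of [I1] other than [x], within [dl] of [x], on the segment towards [y]; comparing
   increments between [x] and [x'] at [t = theta] then gives [|slope - 1| <= e]. *)
pose x' := x + s * (y - x).
have Ix' : I1 x'.
  have [yx'|xy|E] := ltgtP y x; last by rewrite E eqxx in yx.
  - by apply: (I1_itv Iy Ix); rewrite /x'; apply/andP; split; nra.
  - by apply: (I1_itv Ix Iy); rewrite /x'; apply/andP; split; nra.
have x'd : `|x' - x| < dl by rewrite /x' addrAC subrr add0r normrM gtr0_norm.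
have xd : `|x - x| < dl by rewrite subrr normr0.
have td : `|theta - theta| < dl by rewrite subrr normr0.
have key z z' : I1 z -> I1 z' -> `|z - x| < dl -> `|z' - x| < dl -> z < z' ->
    `|slope - 1| <= e.
  move=> Iz Iz' zd zd' zz; have := H theta z z' theta_Theta td Iz Iz' zd zd' zz.
  have -> : of_noise theta z = z by exact: phi_invK.
  have -> : of_noise theta z' = z' by exact: phi_invK.
  rewrite -{1}[z' - z]mul1r -mulrBl normrM [X in _ * X]gtr0_norm ?subr_gt0//.
  by rewrite ler_pM2r ?subr_gt0// distrC.
have [xx|xx|E] := ltgtP x x'.
- exact: key Ix Ix' xd x'd xx.
- exact: key Ix' Ix x'd xd xx.
- move: E => /eqP; rewrite /x' eq_sym -subr_eq0 addrAC subrr add0r mulf_eq0.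
  by rewrite (gt_eqF s0) subr_eq0 (negbTE yx).
Qed.

Lemma of_noise_local (f : R -> R) (e : R) : {for x, continuous f} -> 0 < e ->
  exists2 delta : R, 0 < delta & forall t, Theta t -> `|t - theta| < delta ->
  forall z z', I1 z -> I1 z' -> `|z - x| < delta -> `|z' - x| < delta ->
  `|of_noise t z - of_noise t z' - (z - z')| <= e * `|z - z'| /\
  `|f (of_noise t z) - f x| <= e.
Proof.
move=> cf e0.
have [d1 d10 H1] := of_noise_slope e0.
have /cvgrPdist_le/(_ _ e0)[d2 /= d20 H2] : f y @[y --> x] --> f x by exact: cf.
have [cinv _] := inv_C1.
have [d3 d30 H3] := within_continuous_dist cinv (phi_in theta_Theta Ix) d20.
have [d4 d40 H4] := within_continuous_dist2 phi_cont theta_Theta Ix d30.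
exists (Num.min d1 d4); first by rewrite lt_min d10.
move=> t Tt; rewrite lt_min => /andP[t1 t4] z z' Iz Iz'.
rewrite !lt_min => /andP[z1 z4] /andP[z1' z4'].
split; last first.
  rewrite distrC; apply: H2 => /=; rewrite distrC.
  have := H3 _ (phi_in Tt Iz) (H4 _ _ Tt Iz t4 z4).
  by rewrite -/(inv theta) (phi_invK theta_Theta Ix).
have [zz|zz|->] := ltgtP z z'.
- have := H1 t z z' Tt t1 Iz Iz' z1 z1' zz; rewrite slope1 mul1r => H.
  rewrite [X in _ * X]distrC [X in _ * X]gtr0_norm ?subr_gt0//.
  have -> : of_noise t z - of_noise t z' - (z - z') =
      - (of_noise t z' - of_noise t z - (z' - z)) by ring.
  by rewrite normrN.
- have := H1 t z' z Tt t1 Iz' Iz z1' z1 zz; rewrite slope1 mul1r => H.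
  by rewrite [X in _ * X]gtr0_norm ?subr_gt0.
- by rewrite !subrr normr0 mulr0.
Qed.

End change_of_parameter.

(** * Mean-square recursions *)

Section averaging_step.
Context d (T : measurableType d) (R : realType) (P : probability T R).

Lemma bounded_integrable (g : T -> R) (B : R) : measurable_fun setT g ->
  (forall w, `|g w| <= B) -> P.-integrable setT (fun w => (g w)%:E).
Proof.
move=> mg gB.
apply: (le_integrable _ _ _ (finite_measure_integrable_cst P B measurableT)) => //.
  exact/measurable_EFinP.
by move=> w _ /=; rewrite lee_fin (le_trans (gB w))// ler_norm.
Qed.

Lemma integral_probability_cst (k : R) : (\int[P]_w k%:E = k%:E)%E.
Proof. by have := expectation_cst P k; rewrite unlock. Qed.

(** The inequality [2 * r * (m - c) <= r ^+ 2 + (m - c) ^+ 2] on the cross term trades the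
    coefficient [(1 - s) ^+ 2] for [1 - s] and leaves the squared bias with weight [s], not
    [s ^+ 2]. *)
Lemma averaging_step (Y : T -> R) (B r s c m q : R) : measurable_fun setT Y ->
  (forall w, `|Y w| <= B) -> 0 <= s <= 1 ->
  (\int[P]_w (Y w)%:E = m%:E)%E -> (\int[P]_w (Y w ^+ 2)%:E <= q%:E)%E ->
  (\int[P]_w (((1 - s) * r + s * (Y w - c)) ^+ 2)%:E <=
   ((1 - s) * r ^+ 2 + s * (m - c) ^+ 2 + s ^+ 2 * (2 * q + 2 * c ^+ 2))%:E)%E.
Proof.
move=> mY YB /andP[s0 s1] Ym Yq.
have iY := bounded_integrable mY YB.
have mY2 : measurable_fun setT (fun w => Y w ^+ 2) by exact: measurable_funX.
have iY2 : P.-integrable setT (fun w => (Y w ^+ 2)%:E).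
  apply: (@bounded_integrable _ (B ^+ 2)) => // w.
  by rewrite normrX lerXn2r// ?nnegrE// (le_trans _ (YB w)).
(* The terms free of [Y] once [(Y w - c) ^+ 2] is replaced by [2 * Y w ^+ 2 + 2 * c ^+ 2]; the slack
   is [(s * (Y w + c)) ^+ 2]. *)
pose A := (1 - s) ^+ 2 * r ^+ 2 - 2 * s * (1 - s) * r * c + 2 * s ^+ 2 * c ^+ 2.
apply: (@le_trans _ _ (\int[P]_w (A%:E + ((2 * s * (1 - s) * r)%:E * (Y w)%:E +
    (2 * s ^+ 2)%:E * (Y w ^+ 2)%:E)))%E).
  apply: ge0_le_integral => //.
  - by move=> w _; rewrite lee_fin sqr_ge0.
  - apply/measurable_EFinP; apply: measurable_funX; apply: measurable_funD => //.
    by apply: measurable_funM => //; exact: measurable_funB.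
  - by apply/measurable_EFinP; apply: measurable_funD => //; apply: measurable_funD;
      apply: measurable_funM.
  - move=> w _; rewrite -!EFinM -!EFinD lee_fin /A -subr_ge0.
    have -> : (1 - s) ^+ 2 * r ^+ 2 - 2 * s * (1 - s) * r * c + 2 * s ^+ 2 * c ^+ 2 +
      (2 * s * (1 - s) * r * Y w + 2 * s ^+ 2 * Y w ^+ 2) -
      ((1 - s) * r + s * (Y w - c)) ^+ 2 = (s * (Y w + c)) ^+ 2 by ring.
    exact: sqr_ge0.
have iA : P.-integrable setT (fun w : T => A%:E).
  exact: (finite_measure_integrable_cst P A).
rewrite integralD//; last by apply: integrableD => //; exact: integrableZl.
rewrite integralD//; [|exact: integrableZl..].
rewrite integral_probability_cst !integralZl// Ym.
have /fineK E2 := integrable_fin_num measurableT iY2.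
move: Yq; rewrite -E2 lee_fin => Yq.
rewrite -!EFinM -!EFinD lee_fin /A.
move: (fine _) Yq => q' qq.
have H1 : s ^+ 2 * q' <= s ^+ 2 * q by rewrite ler_wpM2l// sqr_ge0.
have H2 : 0 <= s * (1 - s) * (r - (m - c)) ^+ 2.
  by rewrite mulr_ge0 ?sqr_ge0// mulr_ge0// subr_ge0.
have H3 : 0 <= (s * (m - c)) ^+ 2 by exact: sqr_ge0.
rewrite -subr_ge0 in H1; rewrite -subr_ge0.
rewrite [X in 0 <= X](_ : _ = s * (1 - s) * (r - (m - c)) ^+ 2 + (s * (m - c)) ^+ 2 +
   2 * (s ^+ 2 * q - s ^+ 2 * q')); last by ring.
by rewrite !addr_ge0// mulr_ge0.
Qed.

End averaging_step.

Section consistency.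
Context d (T : measurableType d) (R : realType) (P : probability T R).
Variable eps : nat -> {RV P >-> R}.
Hypotheses (eps_indep : mutually_independent eps) (eps_id : identically_distributed eps).
Variables (I : set R) (a b theta theta0 : R).
Hypotheses (mI : measurable I) (epsI : forall n w, I (eps n w)) (ab : a < b)
  (theta0_ab : a <= theta0 <= b) (theta_ab : a <= theta <= b).
Variables (psi gr : R -> R -> R).
Hypotheses
  (mpsi : measurable_fun (`[a, b] `*` I) (fun p : R * R => psi p.1 p.2))
  (mgr : measurable_fun (`[a, b] `*` I) (fun p : R * R => gr p.1 p.2)).
Variables (gamma : nat -> R) (th : nat -> T -> R).
Hypotheses (th_0 : forall w, th 0%N w = theta0)
  (th_S : forall n w, th n.+1 w =
    projection a b (th n w - gamma n.+1 * gr (th n w) (eps n.+1 w))).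
Variables (K : R -> R) (kappa : R) (h : nat -> R) (x fx : R) (fh : nat -> T -> R).
Hypotheses (mK : measurable_fun setT K) (K0 : forall u, 0 <= K u)
  (K_kappa : forall u, K u <= kappa) (h0 : forall n, (0 < n)%N -> 0 < h n)
  (fhE : forall n w, fh n w = n%:R^-1 * \sum_(1 <= i < n.+1)
    (h i)^-1 * K ((x - psi (th i.-1 w) (eps i w)) / h i)).

Let th_ab n w : a <= th n w <= b.
Proof. by case: n => [|n]; rewrite ?th_0 ?th_S// projection_itv// ltW. Qed.

(** Extension by [0] makes the transition map measurable on the whole space; the chain and the noise
    never leave the rectangle. *)
Let psiT : R * R -> R := (fun p : R * R => psi p.1 p.2) \_ (`[a, b] `*` I).
Let grT : R * R -> R := (fun p : R * R => gr p.1 p.2) \_ (`[a, b] `*` I).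

Let mD : measurable (`[a, b] `*` I : set (R * R)).
Proof. by apply: measurableX => //; exact: measurable_itv. Qed.

Let mpsiT : measurable_fun setT psiT.
Proof. exact: (measurable_restrictT _ mD).1 mpsi. Qed.

Let mgrT : measurable_fun setT grT.
Proof. exact: (measurable_restrictT _ mD).1 mgr. Qed.

Let psiTE t e : a <= t <= b -> I e -> psiT (t, e) = psi t e.
Proof. by move=> tab Ie; rewrite /psiT /patch mem_set//= in_itv. Qed.

Let grTE t e : a <= t <= b -> I e -> grT (t, e) = gr t e.
Proof. by move=> tab Ie; rewrite /grT /patch mem_set//= in_itv. Qed.

Let G n (p : (R * R) * R) : R * R :=
  (projection a b (p.1.1 - gamma n.+1 * grT (p.1.1, p.2)),
   (1 - n.+1%:R^-1) * p.1.2 +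
   n.+1%:R^-1 * ((h n.+1)^-1 * K ((x - psiT (p.1.1, p.2)) / h n.+1) - fx)).

Let mG n : measurable_fun setT (G n).
Proof.
have m1 : measurable_fun setT (fun p : (R * R) * R => (p.1.1, p.2)).
  by apply: measurable_fun_pair => //; apply: measurableT_comp.
apply: measurable_fun_pair.
  apply: measurableT_comp; first exact: measurable_projection.
  apply: measurable_funB; first exact: measurableT_comp.
  by apply: measurable_funM => //; exact: measurableT_comp.
apply: measurable_funD; first by apply: measurable_funM => //; exact: measurableT_comp.
apply: measurable_funM => //; apply: measurable_funB => //; apply: measurable_funM => //.
apply: measurableT_comp => //; apply: measurable_funM => //; apply: measurable_funB => //.
exact: measurableT_comp.
Qed.

(* The pair (parameter estimate, density error) is a Markov chain driven by
   [eps]. *)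
Let S n w : R * R := (th n w, fh n w - fx).

Let S_0 w : S 0%N w = (theta0, - fx).
(* The inverse of [0] is [0], so [fh 0] vanishes and the error starts at [- fx]; the first
   transition has weight [1 - 1 = 0] and forgets it. *)
Proof. by rewrite /S th_0 fhE invr0 mul0r sub0r. Qed.

Let S_S n w : S n.+1 w = G n (S n w, eps n.+1 w).
Proof.
rewrite /S /G /= th_S grTE// psiTE//; congr (_, _).
rewrite !fhE big_nat_recr//=.
set A := \sum_(1 <= i < n.+1) _; set B := (h n.+1)^-1 * _.
have n0 : n.+1%:R != 0 :> R by rewrite pnatr_eq0.
have E : n%:R * (n%:R^-1 * A) = A.
  have [n_0|n_0] := eqVneq n 0%N; first by rewrite /A n_0 big_geq// !mulr0.
  by rewrite mulrA mulfV ?mul1r// pnatr_eq0.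
rewrite -[in LHS]E; set A' := n%:R^-1 * A.
have -> : n%:R = n.+1%:R - 1 :> R by rewrite -natr1 addrK.
by move: (n.+1%:R) n0 => N N0; field.
Qed.

Let mS n : measurable_fun setT (S n) := chain_measurable S_0 S_S mG n.

Let mth n : measurable_fun setT (th n).
Proof. by have := measurableT_comp measurable_fst (mS n); exact. Qed.

Let mfh n : measurable_fun setT (fun w => fh n w - fx).
Proof. by have := measurableT_comp measurable_snd (mS n); exact. Qed.

Let th_bnd n w : `|(th n w - theta) ^+ 2| <= (b - a) ^+ 2.
Proof.
rewrite ger0_norm ?sqr_ge0// -ler_sqrt ?sqr_ge0// !sqrtr_sqr.
have ba : 0 <= b - a by rewrite subr_ge0 ltW.
rewrite (ger0_norm ba) ler_norml.
by move: (th_ab n w) theta_ab => /andP[? ?] /andP[? ?]; apply/andP; split; lra.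
Qed.

Let kappa0 : 0 <= kappa. Proof. exact: le_trans (K0 0) (K_kappa 0). Qed.

(** A crude bound depending on [n], sufficient for integrability of the squared error. *)
Let fh_bnd n : exists B, forall w, `|(fh n w - fx) ^+ 2| <= B.
Proof.
pose B0 := n%:R^-1 * \sum_(1 <= i < n.+1) (h i)^-1 * kappa + `|fx|.
exists (B0 ^+ 2) => w; rewrite normrX lerXn2r ?nnegrE//.
  rewrite addr_ge0// mulr_ge0// big_nat_cond sumr_ge0// => i /andP[/andP[i1 _] _].
  by rewrite mulr_ge0// invr_ge0 ltW// h0.
apply: (le_trans (ler_normB _ _)); rewrite lerD2r fhE.
rewrite normrM ger0_norm// ler_wpM2l//.
rewrite big_nat_cond [leRHS]big_nat_cond ger0_norm.
  apply: ler_sum => i /andP[/andP[i1 _] _].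
  by rewrite ler_wpM2l// invr_ge0 ltW// h0.
by rewrite sumr_ge0// => i /andP[/andP[i1 _] _]; rewrite mulr_ge0// invr_ge0 ltW// h0.
Qed.

Let U n : R := fine (\int[P]_w ((th n w - theta) ^+ 2)%:E).
Let V n : R := fine (\int[P]_w ((fh n w - fx) ^+ 2)%:E).

Let iU n : P.-integrable setT (fun w => ((th n w - theta) ^+ 2)%:E).
Proof.
apply: (@bounded_integrable _ _ _ P _ ((b - a) ^+ 2)) => //.
by apply: measurable_funX; exact: measurable_funB.
Qed.

Let iV n : P.-integrable setT (fun w => ((fh n w - fx) ^+ 2)%:E).
Proof.
have [B fB] := fh_bnd n; apply: (@bounded_integrable _ _ _ P _ B) => //.
by apply: measurable_funX; exact: mfh.
Qed.

Let UE n : (\int[P]_w ((th n w - theta) ^+ 2)%:E = (U n)%:E)%E.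
Proof. by rewrite fineK//; exact: integrable_fin_num. Qed.

Let VE n : (\int[P]_w ((fh n w - fx) ^+ 2)%:E = (V n)%:E)%E.
Proof. by rewrite fineK//; exact: integrable_fin_num. Qed.

Let U0 n : 0 <= U n.
Proof. by apply: fine_ge0; apply: integral_ge0 => w _; rewrite lee_fin sqr_ge0. Qed.

Let V0 n : 0 <= V n.
Proof. by apply: fine_ge0; apply: integral_ge0 => w _; rewrite lee_fin sqr_ge0. Qed.

Variable c : R.
Hypothesis c0 : 0 <= c.
Hypothesis contract : forall t g, a <= t <= b -> 0 <= g ->
  (\int[P]_w ((projection a b (t - g * gr t (eps 0%N w)) - theta) ^+ 2)%:E <=
   ((1 - g + c * g ^+ 2) * (t - theta) ^+ 2)%:E)%E.
Hypotheses (gamma0 : forall n, (0 < n)%N -> 0 < gamma n)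
  (gamma_cvg : gamma n.+1 @[n --> \oo] --> 0)
  (gamma_dvg : series (fun n => gamma n.+1) n @[n --> \oo] --> +oo).

Let U_step n : U n.+1 <= (1 - gamma n.+1 + c * gamma n.+1 ^+ 2) * U n.
Proof.
rewrite -lee_fin -UE EFinM -UE -integralZl//.
have /= -> := chain_tonelli eps_indep eps_id S_0 S_S mG n
  (f := fun s : R * R => ((s.1 - theta) ^+ 2)%:E).
- apply: ge0_le_integral => //.
  + by move=> w _; apply: integral_ge0 => w' _; rewrite lee_fin sqr_ge0.
  + apply: (measurable_chain_integral S_0 S_S mG n
      (f := fun s : R * R => ((s.1 - theta) ^+ 2)%:E)).
      by move=> s; rewrite lee_fin sqr_ge0.
    by apply/measurable_EFinP; apply: measurable_funX; exact: measurable_funB.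
  + by apply: measurable_funeM; apply: (measurable_int P); exact: iU.
  + move=> w _; rewrite -EFinM.
    apply: le_trans (contract (th_ab n w) (ltW (gamma0 (ltn0Sn n)))).
    rewrite le_eqVlt; apply/orP; left; apply/eqP; apply: eq_integral => w' _.
    by rewrite grTE.
- by move=> s; rewrite lee_fin sqr_ge0.
- apply/measurable_EFinP; apply: measurable_funX; exact: measurable_funB.
Qed.

Let U_cvg : U n @[n --> \oo] --> 0.
Proof.
apply: (@linear_recursion_cvg0 _ U (fun n => gamma n.+1 / 2)) => //.
- have : \forall n \near \oo, gamma n.+1 < 2 by apply: cvgr_lt gamma_cvg _ _.
  by apply: filterS => n gn; rewrite ler_pdivrMr// mul1r ltW.
- have -> : series (fun n => gamma n.+1 / 2) =
      fun n => series (fun n => gamma n.+1) n * 2^-1.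
    by apply/funext => n; rewrite /series/= mulr_suml.
  apply/cvgryPge => A; have /cvgryPge/(_ (A * 2)) := gamma_dvg.
  by apply: filterS => n An; rewrite ler_pdivlMr.
- move=> e e0.
  have c20 : 0 < 2 * c + 1 by rewrite ltr_pwDr// mulr_ge0.
  (* Below this threshold [c * gamma ^+ 2 <= gamma / 2], so half of the drift survives; the added
     [1] covers [c = 0]. *)
  have : \forall n \near \oo, gamma n.+1 < (2 * c + 1)^-1.
    by apply: cvgr_lt gamma_cvg _ _; rewrite invr_gt0.
  apply: filterS => n gn; apply: (le_trans (U_step n)).
  have g0 := gamma0 (ltn0Sn n).
  rewrite -[leLHS]addr0 lerD//; last by rewrite mulr_ge0// ?divr_ge0 ?ltW.
  rewrite ler_wpM2r//.
  have H : gamma n.+1 * (2 * c + 1) < 1 by rewrite -ltr_pdivlMr// mul1r.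
  have : gamma n.+1 * (gamma n.+1 * (2 * c + 1)) < gamma n.+1 * 1 by rewrite ltr_pM2l.
  have := sqr_ge0 (gamma n.+1); rewrite expr2; lra.
Qed.

Variables (c1 c2 : R).
Hypotheses (c10 : 0 <= c1) (c20 : 0 <= c2).
Hypothesis kernel_le : forall t s, a <= t <= b -> 0 < s ->
  (\int[P]_w (K ((x - psi t (eps 0%N w)) / s)%R)%:E <= (c1 * s)%:E)%E.
Hypothesis kernel2_le : forall t s, a <= t <= b -> 0 < s ->
  (\int[P]_w (K ((x - psi t (eps 0%N w)) / s)%R ^+ 2)%:E <= (c2 * s)%:E)%E.
Hypothesis kernel_approx : forall e, 0 < e -> exists2 delta : R, 0 < delta &
  forall t s : R, a <= t <= b -> `|t - theta| < delta -> 0 < s < delta ->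
  (((fx - e) * s)%:E <= \int[P]_w (K ((x - psi t (eps 0%N w)) / s)%R)%:E)%E /\
  (\int[P]_w (K ((x - psi t (eps 0%N w)) / s)%R)%:E <= ((fx + e) * s)%:E)%E.
Hypotheses (h_cvg : h n.+1 @[n --> \oo] --> 0)
  (nh_cvg : (n.+1%:R * h n.+1)^-1 @[n --> \oo] --> 0).

Let Y s t w := s^-1 * K ((x - psi t (eps 0%N w)) / s).

Let mY s t : a <= t <= b -> measurable_fun setT (Y s t).
Proof.
move=> tab; apply: measurable_funM => //; apply: measurableT_comp => //.
apply: measurable_funM => //; apply: measurable_funB => //.
rewrite (_ : (fun w => psi t (eps 0%N w)) = fun w => psiT (t, eps 0%N w)); last first.
  by apply/funext => w; rewrite psiTE.
by apply: measurableT_comp => //; exact: measurable_fun_pair.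
Qed.

Let Y_bnd s t w : 0 < s -> `|Y s t w| <= s^-1 * kappa.
Proof.
by move=> s0; rewrite ger0_norm ?mulr_ge0 ?invr_ge0 ?(ltW s0)// ler_wpM2l// invr_ge0 ltW.
Qed.

Let m s t : R := fine (\int[P]_w (Y s t w)%:E).

Let mE s t : a <= t <= b -> 0 < s -> (\int[P]_w (Y s t w)%:E = (m s t)%:E)%E.
Proof.
move=> tab s0; rewrite fineK//; apply: integrable_fin_num => //.
by apply: (@bounded_integrable _ _ _ P _ (s^-1 * kappa)) => [|w];
    [exact: mY|exact: Y_bnd].
Qed.

Let mKE s t : a <= t <= b -> 0 < s ->
  (\int[P]_w (K ((x - psi t (eps 0%N w)) / s)%R)%:E = (s * m s t)%:E)%E.
Proof.
move=> tab s0; rewrite EFinM -mE// -integralZl//; last first.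
  by apply: (@bounded_integrable _ _ _ P _ (s^-1 * kappa)) => [|w];
    [exact: mY|exact: Y_bnd].
by apply: eq_integral => w _; rewrite -EFinM /Y mulrA mulfV ?mul1r// gt_eqF.
Qed.

Let Y2_le s t : a <= t <= b -> 0 < s -> (\int[P]_w (Y s t w ^+ 2)%:E <= (c2 / s)%:E)%E.
Proof.
move=> tab s0.
have mKs : measurable_fun setT (fun w => K ((x - psi t (eps 0%N w)) / s)).
  rewrite (_ : (fun w => _) = fun w => s * Y s t w); last first.
    by apply/funext => w; rewrite /Y mulrA mulfV ?mul1r// gt_eqF.
  by apply: measurable_funM => //; exact: mY.
rewrite (_ : (fun w => (Y s t w ^+ 2)%:E) =
  (fun w => (s ^- 2)%:E * (K ((x - psi t (eps 0%N w)) / s)%R ^+ 2)%:E)%E); last first.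
  by apply/funext => w; rewrite -EFinM /Y exprMn exprVn.
rewrite ge0_integralZl//; first last.
- by rewrite lee_fin invr_ge0 sqr_ge0.
- by move=> w _; rewrite lee_fin sqr_ge0.
- by apply/measurable_EFinP; exact: measurable_funX.
apply: (@le_trans _ _ ((s ^- 2)%:E * (c2 * s)%:E)%E).
  by apply: lee_wpmul2l; [rewrite lee_fin invr_ge0 sqr_ge0|exact: kernel2_le].
rewrite -EFinM lee_fin le_eqVlt; apply/orP; left; apply/eqP; field.
by rewrite gt_eqF.
Qed.

(** If [t] is within [dl] of [theta], [kernel_approx] applies; otherwise the crude bound
    [(c1 + |fx|) ^+ 2] is at most [C * (t - theta) ^+ 2] since [|t - theta| >= dl]. The result is
    linear in the squared parameter error, hence ready to be integrated. *)
Let m_close e : 0 < e -> exists C : R, [/\ 0 <= C & \forall n \near \oo,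
  forall t, a <= t <= b -> (m (h n.+1) t - fx) ^+ 2 <= e + C * (t - theta) ^+ 2].
Proof.
move=> e0; pose e' := Num.min 1 e.
have e'0 : 0 < e' by rewrite lt_min ltr01.
have e'e : e' ^+ 2 <= e.
  rewrite expr2 (@le_trans _ _ (1 * e'))//.
    by rewrite ler_wpM2r ?(ltW e'0)// ge_min lexx.
  by rewrite mul1r ge_min lexx orbT.
have [dl dl0 H] := kernel_approx e'0.
pose C := (c1 + `|fx|) ^+ 2 / dl ^+ 2.
exists C; split; first by rewrite divr_ge0 ?sqr_ge0.
have : \forall n \near \oo, h n.+1 < dl by apply: cvgr_lt h_cvg _ _.
apply: filterS => n hn t tab.
have hn0 := h0 (ltn0Sn n).
have [td|td] := ltP `|t - theta| dl.
  have [] := H t (h n.+1) tab td _; first by rewrite hn0.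
  rewrite mKE// !lee_fin (mulrC (h n.+1)) !ler_pM2r// => l1 l2.
  apply: (@le_trans _ _ (e' ^+ 2)).
    rewrite -[leLHS]real_normK ?num_real// lerXn2r ?nnegrE// ?(ltW e'0)//.
    by rewrite ler_norml; apply/andP; split; lra.
  by rewrite (le_trans e'e)// lerDl mulr_ge0 ?sqr_ge0// divr_ge0 ?sqr_ge0.
have m0 : 0 <= m (h n.+1) t.
  apply: fine_ge0; apply: integral_ge0 => w _.
  by rewrite lee_fin mulr_ge0// invr_ge0 ltW.
have mc : m (h n.+1) t <= c1.
  by have := kernel_le tab hn0; rewrite mKE// lee_fin mulrC ler_pM2r.
apply: (@le_trans _ _ ((c1 + `|fx|) ^+ 2)).
  rewrite -[leLHS]real_normK ?num_real// lerXn2r ?nnegrE ?addr_ge0//.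
  by rewrite (le_trans (ler_normB _ _))// lerD2r ger0_norm.
apply: (@le_trans _ _ (C * (t - theta) ^+ 2)); last by rewrite lerDr ltW.
rewrite /C mulrAC ler_pdivlMr ?exprn_gt0// ler_wpM2l ?sqr_ge0//.
by rewrite -[leRHS]real_normK ?num_real// lerXn2r ?nnegrE// ltW.
Qed.

(** [averaging_step] with weight [1 / n.+1] and the parameter frozen at [th n w], then integration
    over the past, which turns the bias bound into [e + C * U n]. The second moment of [Y] is of
    order [1 / h]. *)
Let V_step n C e : 0 <= C -> 0 <= e ->
  (forall t, a <= t <= b -> (m (h n.+1) t - fx) ^+ 2 <= e + C * (t - theta) ^+ 2) ->
  V n.+1 <= (1 - n.+1%:R^-1) * V n +
    n.+1%:R^-1 * (e + C * U n + n.+1%:R^-1 * (2 * (c2 / h n.+1) + 2 * fx ^+ 2)).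
Proof.
move=> C0 e0 Hm.
set s := n.+1%:R^-1.
have s0 : 0 <= s by rewrite /s invr_ge0.
have s1 : s <= 1 by rewrite /s invf_le1 ?ler1n ?ltr0n.
set q := 2 * (c2 / h n.+1) + 2 * fx ^+ 2.
have q0 : 0 <= q.
  by rewrite /q addr_ge0// mulr_ge0 ?sqr_ge0// divr_ge0// ltW// h0.
rewrite -lee_fin -VE.
apply: (@le_trans _ _ (\int[P]_w ((s * e + s * s * q)%:E +
  ((1 - s)%:E * ((fh n w - fx) ^+ 2)%:E +
   (s * C)%:E * ((th n w - theta) ^+ 2)%:E)))%E).
  have /= -> := chain_tonelli eps_indep eps_id S_0 S_S mG n
    (f := fun z : R * R => (z.2 ^+ 2)%:E).
  - apply: ge0_le_integral => //.
    + by move=> w _; apply: integral_ge0 => w' _; rewrite lee_fin sqr_ge0.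
    + apply: (measurable_chain_integral S_0 S_S mG n
        (f := fun z : R * R => (z.2 ^+ 2)%:E)).
        by move=> z; rewrite lee_fin sqr_ge0.
      by apply/measurable_EFinP; exact: measurable_funX.
    + apply/measurable_EFinP; apply: measurable_funD => //.
      by apply: measurable_funD; apply: measurable_funM => //;
        apply: measurable_funX => //; exact: measurable_funB.
    + move=> w _; have tab := th_ab n w; have hn0 := h0 (ltn0Sn n).
      have step := averaging_step (fh n w - fx) fx (mY (h n.+1) tab)
        (fun w' => Y_bnd (th n w) w' hn0) (introT andP (conj s0 s1))
        (mE tab hn0) (Y2_le tab hn0).
      rewrite -!EFinM -!EFinD.
      apply: le_trans (le_trans step _).
        rewrite le_eqVlt; apply/orP; left; apply/eqP; apply: eq_integral => w' _.
        by rewrite psiTE.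
      rewrite lee_fin -/q.
      have := ler_wpM2l s0 (Hm _ tab).
      by rewrite mulrDr mulrA expr2; lra.
  - by move=> z; rewrite lee_fin sqr_ge0.
  - by apply/measurable_EFinP; exact: measurable_funX.
have ic : P.-integrable setT (fun w : T => (s * e + s * s * q)%:E).
  exact: (finite_measure_integrable_cst P (s * e + s * s * q)).
rewrite integralD//; last by apply: integrableD => //; exact: integrableZl.
rewrite integralD//; [|exact: integrableZl..].
rewrite integral_probability_cst !integralZl// VE UE -!EFinM -!EFinD lee_fin.
by rewrite le_eqVlt; apply/orP; left; apply/eqP; ring.
Qed.

Lemma recursive_estimator_consistent :
  (\int[P]_w ((fh n w - fx) ^+ 2)%:E)%E @[n --> \oo] --> 0%E.
Proof.
rewrite (_ : (fun n => _) = EFin \o V); last by apply/funext => n; rewrite VE.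
apply: cvg_EFin; first exact: nearW.
apply: (@linear_recursion_cvg0 _ V (fun n => n.+1%:R^-1)) => //.
- by apply: nearW => n; rewrite invf_le1 ?ler1n ?ltr0n.
- apply: nondecreasing_dvgn_lt; last exact: dvg_harmonic.
  by apply: nondecreasing_series => n _ _; rewrite invr_ge0.
- move=> e e0.
  (* One third each for the bias near [theta], the parameter error and the variance. *)
  have e30 : 0 < e / 3 by rewrite divr_gt0.
  have [C [C0 Cm]] := m_close e30.
  have t1 : \forall n \near \oo, C * U n <= e / 3.
    have CU : C * U n @[n --> \oo] --> 0 by rewrite -(mulr0 C); exact: cvgMr U_cvg.
    have : \forall n \near \oo, C * U n < e / 3 by apply: cvgr_lt CU _ _.
    by apply: filterS => n; exact: ltW.
  have t2 : \forall n \near \oo,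
      n.+1%:R^-1 * (2 * (c2 / h n.+1) + 2 * fx ^+ 2) <= e / 3.
    have H : 2 * c2 * (n.+1%:R * h n.+1)^-1 + 2 * fx ^+ 2 * n.+1%:R^-1 @[n --> \oo] --> 0.
      have H1 : 2 * c2 * (n.+1%:R * h n.+1)^-1 @[n --> \oo] --> 0.
        by rewrite -(mulr0 (2 * c2)); exact: cvgMr nh_cvg.
      have H2 : 2 * fx ^+ 2 * n.+1%:R^-1 @[n --> \oo] --> 0.
        by rewrite -(mulr0 (2 * fx ^+ 2)); apply: cvgMr; exact: cvg_harmonic.
      by rewrite -[X in _ --> X]addr0; exact: cvgD H1 H2.
    have : \forall n \near \oo, 2 * c2 * (n.+1%:R * h n.+1)^-1 +
        2 * fx ^+ 2 * n.+1%:R^-1 < e / 3 by apply: cvgr_lt H _ _.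
    apply: filterS => n /ltW; apply: le_trans.
    by rewrite invfM le_eqVlt; apply/orP; left; apply/eqP; ring.
  apply: filterS3 Cm t1 t2 => n Hm Hn1 Hn2.
  apply: (le_trans (V_step C0 (ltW e30) Hm)); rewrite lerD2l ler_wpM2l ?invr_ge0//.
  apply: (@le_trans _ _ (e / 3 + e / 3 + e / 3)); last by lra.
  by rewrite lerD// lerD2l.
Qed.

End consistency.

(** * Step sizes and bandwidths *)

Lemma powR_natS_cvg0 (R : realType) (beta : R) : 0 < beta ->
  n.+1%:R `^ (- beta) @[n --> \oo] --> 0.
Proof.
move=> b0; apply/cvgrPdist_le => e e0.
have M0 : 0 <= e `^ (- beta^-1) by exact: powR_ge0.
near=> n.
have nM : e `^ (- beta^-1) <= n.+1%:R.
  rewrite (@le_trans _ _ n%:R) ?ler_nat//; near: n; exact: nbhs_infty_ger.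
rewrite sub0r normrN ger0_norm ?powR_ge0// powRN -[leRHS]invrK.
rewrite lef_pV2 ?posrE ?invr_gt0 ?powR_gt0 ?ltr0n//.
have := ge0_ler_powR (ltW b0) M0 (ler0n _ n.+1) nM.
by rewrite -powRrM mulNr mulVf ?gt_eqF// powR_inv1 ?(ltW e0).
Unshelve. all: by end_near. Qed.

(** If [e <= g n.+1], monotonicity makes the first [n.+1] squares at least [e ^+ 2], so
    [n.+1 * e ^+ 2] is at most the finite total, which fails for large [n]. *)
Lemma nonincreasing_square_summable_cvg0 (R : realType) (g : nat -> R) :
  (forall n, (0 < n)%N -> 0 < g n) ->
  (forall m n, (0 < m <= n)%N -> g n <= g m) ->
  (\sum_(1 <= n <oo) (g n ^+ 2)%:E < +oo)%E -> g n.+1 @[n --> \oo] --> 0.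
Proof.
move=> g0 gd gs; apply/cvgrPdist_lt => e e0.
have partial n : (\sum_(1 <= k < n.+1) (g k ^+ 2)%:E <=
    \sum_(1 <= k <oo) (g k ^+ 2)%:E)%E.
  by apply: nneseries_lim_ge => k ? ?; rewrite lee_fin sqr_ge0.
have fin : (\sum_(1 <= n <oo) (g n ^+ 2)%:E)%E \is a fin_num.
  by rewrite ge0_fin_numE// nneseries_ge0// => n _ _; rewrite lee_fin sqr_ge0.
near=> n.
rewrite sub0r normrN gtr0_norm ?g0// ltNge; apply/negP => eg.
have : ((n.+1%:R * e ^+ 2)%:E <= \sum_(1 <= k < n.+2) (g k ^+ 2)%:E)%E.
  rewrite sumEFin lee_fin.
  apply: (@le_trans _ _ (\sum_(1 <= k < n.+2) e ^+ 2)).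
    by rewrite sumr_const_nat subn1 mulr_natl.
  rewrite big_nat_cond [leRHS]big_nat_cond; apply: ler_sum => k /andP[/andP[k1 kn] _].
  have ek : e <= g k by apply: le_trans eg _; apply: gd; rewrite k1.
  by rewrite lerXn2r// nnegrE ltW// g0.
apply/negP; rewrite -ltNge; apply: (le_lt_trans (partial _)).
rewrite -(fineK fin) lte_fin -ltr_pdivrMr ?exprn_gt0//.
rewrite (@lt_le_trans _ _ n%:R) ?ler_nat//; near: n; exact: nbhs_infty_gtr.
Unshelve. all: by end_near. Qed.

Lemma nneseries_dvg_series (R : realType) (g : nat -> R) :
  (forall n, (0 < n)%N -> 0 < g n) ->
  (\sum_(1 <= n <oo) (g n)%:E = +oo)%E ->
  series (fun n => g n.+1) n @[n --> \oo] --> +oo.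
Proof.
move=> g0 gs.
have : (\sum_(1 <= k < n) (g k)%:E)%E @[n --> \oo] --> +oo%E.
  rewrite -gs; apply: is_cvg_nneseries => k k1 _.
  by rewrite lee_fin ltW// g0.
move=> /cvgeyPge H; apply/cvgryPge => A.
have [N _ HN] := H A; exists N => // n /= Nn.
have := HN n.+1 (leqW Nn); rewrite /= sumEFin lee_fin => /le_trans; apply.
by rewrite /series/= big_add1.
Qed.

(** * Instantiating the abstract consistency result in the model *)

Theorem theorem4p2 (R : realType) (d : measure_display) (T : measurableType d)
    (P : probability T R)
    (* the model *)
    (Theta I1 I2 : set R) (phi : R -> R -> R) (theta : R)
    (eps : nat -> {RV P >-> R})
    (Theta_itv : is_interval Theta) (theta_Theta : Theta theta)
    (I1_itv : is_interval I1)
    (eps_I1 : forall n w, I1 (eps n w))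
    (eps_indep : mutually_independent eps)
    (eps_id : identically_distributed eps)
    (* the algorithm *)
    (a b theta0 : R) (gamma : nat -> R)
    (theta0_ab : `[a, b]%classic theta0)
    (gamma_gt0 : forall n, (0 < n)%N -> 0 < gamma n)
    (gamma_decr : forall m n, (0 < m <= n)%N -> gamma n <= gamma m)
    (gamma_sum : (\sum_(1 <= n <oo) (gamma n)%:E = +oo)%E)
    (gamma_sum2 : (\sum_(1 <= n <oo) (gamma n ^+ 2)%:E < +oo)%E)
    (* the kernel and the bandwidth *)
    (K : R -> R) (alpha : R)
    (K_ge0 : forall u, 0 <= K u)
    (K_sym : forall u, K (- u) = K u)
    (K_int : lebesgue_measure.-integrable [set: R] (EFin \o K))
    (K_bounded : [bounded K u | u in [set: R]])
    (K_mass : (\int[lebesgue_measure]_u (K u)%:E = 1)%E)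
    (K_pinfty : `|u| * K u @[u --> +oo] --> (0 : R))
    (K_ninfty : `|u| * K u @[u --> -oo] --> (0 : R))
    (K_moment2 : (\int[lebesgue_measure]_u (u ^+ 2 * K u)%:E < +oo)%E)
    (alpha01 : 0 < alpha < 1)
    (* (i) *)
    (phi_bij : forall t, Theta t -> set_bij I1 I2 (phi t))
    (phi_incr : forall t, Theta t ->
      forall x y, I1 x -> I1 y -> x < y -> phi t x < phi t y)
    (* (ii) *)
    (phi_inv_C1 : forall x, I2 x -> Ck_on 1 Theta (phi_inv I1 phi ^~ x))
    (* (iii) *)
    (phi_inv_L2 : forall t, Theta t ->
      ('E_P[fun w => (`|phi_inv I1 phi t (phi theta (eps 0%N w))| ^+ 2)%R]
         < +oo)%E)
    (* (iv) *)
    (dphi_inv_L4 : forall B : set R, compact B -> B !=set0 -> B `<=` Theta ->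
      P.-integrable [set: T] (fun w => ereal_sup
        [set (`|dphi_inv Theta I1 phi t (phi theta (eps 0%N w))| ^+ 4)%:E
           | t in B]))
    (* (v) *)
    (a_lt_b : a < b) (ab_Theta : `[a, b] `<=` Theta)
    (theta_ab : `]a, b[%classic theta)
    (dM_sign : forall t, `[a, b]%classic t -> t != theta ->
      0 < (t - theta) * dM Theta I1 phi theta eps t)
    (* (vi) *)
    (phi_inv_D2 : forall x, I2 x ->
      derivable_on Theta (phi_inv I1 phi ^~ x) /\
      derivable_on Theta (derive_on Theta (phi_inv I1 phi ^~ x)))
    (d2phi_inv_L2 : forall B : set R, compact B -> B !=set0 -> B `<=` Theta ->
      P.-integrable [set: T] (fun w => ereal_sup
        [set (`|d2phi_inv Theta I1 phi t (phi theta (eps 0%N w))| ^+ 2)%:E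
           | t in B]))
    (* (vii) *)
    (d2M_ge : forall t, `[a, b]%classic t ->
      2^-1 <= d2M Theta I1 phi theta eps t)
    (* the density of the noise and (viii) *)
    (f : R -> R) (f_density : is_density (eps 0%N) f)
    (f_D2 : forall x, I1 x -> derivable f x 1 /\ derivable (derive1 f) x 1)
    (f_C2 : {within I1, continuous (derive1n 2 f)})
    (f_bounded : forall k, (k <= 2)%N -> [bounded derive1n k f x | x in I1])
    (* (ix) *)
    (phi_C3 : forall t, Theta t -> Ck_on 3 I1 (phi t))
    (* (x) *)
    (phi_inv_C3 : Ck_on 3 I2 (phi_inv I1 phi theta))
    (phi_inv_bounded : forall k, (1 <= k <= 3)%N ->
      [bounded deriven_on I2 k (phi_inv I1 phi theta) x | x in I2])
    (* (xi) *)
    (phi_bounded : forall k, (1 <= k <= 3)%N ->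
      [bounded deriven_on I1 k (phi p.1) p.2 | p in Theta `*` I1])
    (* (xii) *)
    (phi_C2 : Ck_on2 2 Theta I1 phi)
    (partial_bounded : forall x, I1 x ->
      [bounded partial1_on Theta phi t x | t in Theta])
    (partial_d_bounded : forall x, I1 x ->
      [bounded partial1_on Theta (partial2_on I1 phi) t x | t in Theta]) :
  forall x, I1 x ->
    ('E_P[fun w =>
      (`|f_hat Theta I1 phi theta eps a b theta0 gamma K alpha n x w
         - f x| ^+ 2)%R])%E @[n --> \oo] --> 0%E.
Proof.
move=> x Ix.
have [F F0 fF] := bounded_exists (f_bounded 0%N isT).
have [kappa _ K_kappa] := bounded_exists K_bounded.
have [C1 C10 HC1] := bounded_exists (phi_bounded 1%N isT).
have [C2 C20 HC2] := bounded_exists (phi_inv_bounded 1%N isT).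
pose C := C1 + C2.
have C0 : 0 < C by rewrite addr_gt0.
have dphi_C t z : Theta t -> I1 z -> `|derive_on I1 (phi t) z| <= C.
  by move=> Tt Iz; rewrite (le_trans (HC1 (t, z) (conj Tt Iz)))// lerDl ltW.
have dinv_C y : I2 y -> `|derive_on I2 (phi_inv I1 phi theta) y| <= C.
  by move=> Iy; rewrite (le_trans (HC2 y Iy))// lerDr ltW.
have phi_D t : Theta t -> {within I1, continuous (phi t)} /\ derivable_on I1 (phi t).
  by move=> /phi_C3[? []].
have inv_C1 : Ck_on 1 I2 (phi_inv I1 phi theta).
  by have [? [? [? _]]] := phi_inv_C3.
have [phi_cont [_ _ _ [dphi_cont _]]] := phi_C2.
have [/andP[at_ tb] tab] : a < theta < b /\ a <= theta <= b.
  move: theta_ab; rewrite /= in_itv/= => /andP[? ?].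
  by rewrite !ltW//; split => //; apply/andP.
have mI1 : measurable I1 by exact: is_interval_measurable.
have mK : measurable_fun setT K.
  by apply/measurable_EFinP; exact: (measurable_int _ K_int).
have inTheta t : a <= t <= b -> Theta t by move=> tt; apply: ab_Theta; rewrite /= in_itv.
(* [f] is differentiable at [x] in the two-sided sense, so this continuity is along the whole line,
   as [density_pos_interior] requires. *)
have cfx : {for x, continuous f}.
  have [fD _] := f_D2 _ Ix.
  by apply: differentiable_continuous; exact/derivable1_diffP.
have [_ f_ge0 _] := f_density.
pose psi := to_noise I1 phi theta.
pose chi := of_noise I1 phi theta.
have psiI t e : a <= t <= b -> I1 e -> I1 (psi t e).
  by move=> /inTheta; exact: (to_noise_in theta_Theta phi_bij).
have chiI t e : a <= t <= b -> I1 e -> I1 (chi t e).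
  by move=> /inTheta; exact: (of_noise_in theta_Theta phi_bij).
have psiK t e : a <= t <= b -> I1 e -> chi t (psi t e) = e.
  by move=> /inTheta; exact: (to_noiseK theta_Theta phi_bij).
have chiK t e : a <= t <= b -> I1 e -> psi t (chi t e) = e.
  by move=> /inTheta; exact: (of_noiseK theta_Theta phi_bij).
have mpsi t : a <= t <= b -> measurable_fun I1 (psi t).
  move=> /inTheta Tt.
  exact: (measurable_to_noise theta_Theta I1_itv phi_bij phi_incr Tt).
have mchi t : a <= t <= b -> measurable_fun I1 (chi t).
  move=> /inTheta Tt.
  exact: (measurable_of_noise theta_Theta I1_itv phi_bij phi_incr Tt).
have chiL t z z' : a <= t <= b -> I1 z -> I1 z' ->
    `|chi t z - chi t z'| <= C * C * `|z - z'|.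
  move=> /inTheta Tt; exact: (of_noise_lipschitz theta_Theta I1_itv phi_bij
    phi_incr phi_D inv_C1 dphi_C dinv_C).
have CC0 : 0 < C * C by rewrite mulr_gt0.
have fF' e : I1 e -> f e <= F by move=> Ie; rewrite (le_trans (ler_norm _))// fF.
have klocal e : 0 < e -> exists2 delta : R, 0 < delta & forall t, a <= t <= b ->
    `|t - theta| < delta ->
    forall z z', I1 z -> I1 z' -> `|z - x| < delta -> `|z' - x| < delta ->
    `|chi t z - chi t z' - (z - z')| <= e * `|z - z'| /\
    `|f (chi t z) - f x| <= e.
  move=> e0.
  have nontriv := density_support_nontrivial f_density (eps_I1 0%N) x.
  have [dl dl0 H] := of_noise_local theta_Theta I1_itv phi_bij phi_incr phi_D
    inv_C1 C0 dphi_C dinv_C phi_cont dphi_cont Ix nontriv cfx e0.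
  by exists dl => // t /inTheta; exact: H.
have fpos := density_pos_interior f_density I1_itv (eps_I1 0%N) Ix cfx.
have kle t s (G : R -> \bar R) (tt : a <= t <= b) (s0 : 0 < s) :=
  @kernel_mean_le _ _ _ P (eps 0%N) f I1 f_density I1_itv (eps_I1 0%N) F F0 fF'
    psi chi [set t | a <= t <= b] (C * C) CC0 psiI psiK mpsi chiL x s t setT G
    tt s0 measurableT.
have kapprox := @kernel_mean_approx _ _ _ P (eps 0%N) f I1 f_density I1_itv (eps_I1 0%N)
  F F0 fF' K K_ge0 mK K_mass psi chi [set t | a <= t <= b] (C * C) CC0 psiI chiI psiK chiK
  mpsi mchi chiL x theta (f_ge0 x) fpos klocal.
pose W w := ereal_sup [set (`|dphi_inv Theta I1 phi t (phi theta (eps 0%N w))| ^+ 4)%:E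
  | t in `[a, b]].
have iW : P.-integrable setT W.
  apply: dphi_inv_L4 => //; first exact: segment_compact.
  by exists a; rewrite /= in_itv/= lexx ltW.
have dpsiW t w : a <= t <= b ->
    ((`|derive_on Theta (psi ^~ (eps 0%N w)) t| ^+ 4)%:E <= W w)%E.
  by move=> tt; apply: ereal_sup_ubound; exists t => //=; rewrite in_itv.
have I2phi e : I1 e -> I2 (phi theta e) by exact: (phi_in phi_bij theta_Theta).
have psi_D e : I1 e -> derivable_on Theta (psi ^~ e).
  by move=> /I2phi/phi_inv_C1[_ []].
have psi_C e : I1 e -> {within Theta, continuous (psi ^~ e)}.
  by move=> /I2phi/phi_inv_C1[].
have dpsi_C e : I1 e -> {within Theta, continuous (derive_on Theta (psi ^~ e))}.
  by move=> /I2phi/phi_inv_C1[_ [_ []]].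
have psi_theta e : I1 e -> psi theta e = e.
  exact: (to_noise_theta theta_Theta phi_bij).
pose gr t e := - 2 * derive_on Theta (psi ^~ e) t * (e - psi t e).
have thab : a < theta < b by rewrite at_.
have mpsi2 := measurable_psi2 mI1 a_lt_b ab_Theta psi_C mpsi.
have mgr : measurable_fun (`[a, b] `*` I1) (fun p : R * R => gr p.1 p.2).
  have mdpsi2 := measurable_dpsi2 mI1 a_lt_b ab_Theta psi_D dpsi_C mpsi.
  apply: measurable_funM; first exact: measurable_funM.
  by apply: measurable_funB => //; exact: measurable_funTS.
have inab t : a <= t <= b -> `[a, b]%classic t by rewrite /= in_itv.
have contract := gradient_step_contracts (eps_I1 0%N) mI1 a_lt_b ab_Theta thab
  psi_D psi_C psi_theta mpsi iW dpsiW
  (fun t tt => dM_sign t (inab t tt)) (fun t tt => d2M_ge t (inab t tt)).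
have w0 : 0 <= 4 * fine (\int[P]_w W w)%E.
  by rewrite mulr_ge0//; exact: (mean_bound_ge0 thab dpsiW).
have /andP[alpha0 alpha1] := alpha01.
have h0 n : (0 < n)%N -> 0 < bandwidth alpha n.
  by move=> n0; rewrite /bandwidth powR_gt0// ltr0n.
have h_cvg : bandwidth alpha n.+1 @[n --> \oo] --> (0 : R) by exact: powR_natS_cvg0.
have nh_cvg : (n.+1%:R * bandwidth alpha n.+1)^-1 @[n --> \oo] --> (0 : R).
  (* [n h_n = n^(1 - alpha)], which diverges because [alpha < 1]. *)
  rewrite (_ : (fun n => _) = fun n => n.+1%:R `^ (- (1 - alpha))).
    by apply: powR_natS_cvg0; rewrite subr_gt0.
  apply/funext => n; rewrite /bandwidth [RHS]powRN; congr (_^-1).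
  by rewrite powRD ?pnatr_eq0 ?implybT// powRr1.
have th0ab : a <= theta0 <= b by move: theta0_ab; rewrite /= in_itv.
have kappa_le u : K u <= kappa by rewrite (le_trans (ler_norm _))// K_kappa.
have kappa0 : 0 <= kappa by exact: le_trans (K_ge0 0) (kappa_le 0).
have FCC : 0 <= F * (C * C) by rewrite mulr_ge0 ?ltW.
have kernel_le t s : a <= t <= b -> 0 < s ->
    (\int[P]_w (K ((x - psi t (eps 0%N w)) / s)%R)%:E <= (F * (C * C) * s)%:E)%E.
  move=> tt s0; have := kle t s (EFin \o K) tt s0 _ _.
  rewrite preimage_setT K_mass mule1; apply; first by move=> u; rewrite lee_fin.
  exact/measurable_EFinP.
have kernel2_le t s : a <= t <= b -> 0 < s ->
    (\int[P]_w (K ((x - psi t (eps 0%N w)) / s)%R ^+ 2)%:E <=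
     (F * (C * C) * kappa * s)%:E)%E.
  move=> tt s0.
  have mK2 : measurable_fun setT (fun u => (K u ^+ 2)%:E).
    by apply/measurable_EFinP; exact: measurable_funX.
  have := kle t s (fun u => (K u ^+ 2)%:E) tt s0 (fun u => _) mK2.
  rewrite preimage_setT => H; apply: (le_trans (H _)).
    by move=> u; rewrite lee_fin sqr_ge0.
  rewrite [F * (C * C) * kappa * s]mulrAC [X in (_ <= X)%E]EFinM; apply: lee_wpmul2l.
    by rewrite lee_fin mulr_ge0// ltW.
  (* The square of the kernel is at most [kappa] times the kernel, whose mass is [1]. *)
  apply: (@le_trans _ _ (\int[lebesgue_measure]_u (kappa%:E * (K u)%:E))%E).
    apply: ge0_le_integral => //.
    - by move=> u _; rewrite lee_fin sqr_ge0.
    - by apply/measurable_EFinP; exact: measurable_funM.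
    - by move=> u _; rewrite -EFinM lee_fin expr2 ler_wpM2r.
  rewrite ge0_integralZl// ?K_mass ?mule1//.
  - exact/measurable_EFinP.
  - by move=> u _; rewrite lee_fin.
have := recursive_estimator_consistent eps_indep eps_id mI1 eps_I1 a_lt_b th0ab tab
  mpsi2 mgr (th := theta_hat Theta I1 phi theta eps a b theta0 gamma) (fun=> erefl)
  (fun n w => erefl) mK K_ge0 kappa_le h0
  (fh := fun n => f_hat Theta I1 phi theta eps a b theta0 gamma K alpha n x)
  (fun n w => erefl) w0 contract gamma_gt0
  (nonincreasing_square_summable_cvg0 gamma_gt0 gamma_decr gamma_sum2)
  (nneseries_dvg_series gamma_gt0 gamma_sum) FCC (mulr_ge0 FCC kappa0)
  kernel_le kernel2_le kapprox
  h_cvg nh_cvg.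
rewrite unlock; under eq_fun do under eq_integral do rewrite -real_normK ?num_real//.
exact.
Qed.
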